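(* Let $(G,\phi)$ be a finite magnetic group, let $\sigma:\mathbb{Z}/2\times\mathbb{Z}/2\to\mathbb{C}^*$ be the 2-cocycle $\sigma(a,b)=e^{\pi i ab}$, and suppose that the cohomology class of $\phi^*\sigma$ is trivial, i.e. $[\phi^*\sigma]=1$ in $H^2(G,\mathbb{C}^*_\phi)$. Then the magnetic equivariant K-theory $\mathbf{K}^*_G$ is 4-periodic: $\mathbf{K}^{p,q+4}_G\cong\mathbf{K}^{p,q}_G$ for all integers $p,q\geq 0$.
   Context: A (finite) magnetic group $(G,\phi)$ is a finite group $G$ with a surjective homomorphism $\phi:G\to\mathbb{Z}/2=\{0,1\}$. $\mathbb{K}$ is complex conjugation and $\mathbb{K}^{\phi(g)}$ is $\mathrm{id}$ if $\phi(g)=0$ and $\mathbb{K}$ if $\phi(g)=1$. $H^2(G,\mathbb{C}^*_\phi)$ is group cohomology with $G$ acting on $\mathbb{C}^*$ by $\lambda\mapsto\mathbb{K}^{\phi(g)}\lambda$. $\phi^*\sigma(g,h)=\sigma(\phi(g),\phi(h))$. $C^{p,q}_{\mathbb{R}}$ is the real Clifford algebra generated by degree-one elements $e_1,\dots,e_{p+q}$ with $e_ie_j=-e_je_i$ for $i\ne j$, $e_j^2=1$ for $j\le p$, $e_j^2=-1$ for $j>p$; it is $\mathbb{Z}/2$-graded. $C^{p,q}_{\mathbb{C}}=C^{p,q}_{\mathbb{R}}\otimes_{\mathbb{R}}\mathbb{C}$, on which $g\in G$ acts by $\mathrm{id}\otimes\mathbb{K}^{\phi(g)}$. Let $C^{p,q}_{\mathbb{C}}[G]$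 be the algebra of linear combinations of symbols $\lfloor a,g\rfloor$ ($a\in C^{p,q}_{\mathbb{C}}$, $g\in G$, additive in $a$) with product $\lfloor a,g\rfloor\lfloor b,h\rfloor=\lfloor a\,(g\cdot b),gh\rfloor$, graded by the degree of $a$. For $R=C^{p,q}_{\mathbb{C}}[G]$, let $\mathcal{E}^R$ be the category of finite-dimensional $\mathbb{Z}/2$-graded complex $R$-modules (complex scalars act as the scalars of $C^{p,q}_{\mathbb{C}}$, so that $\lfloor a,g\rfloor$ acts $\mathbb{C}$-linearly or antilinearly according to $\phi(g)$) with degree-zero module maps, and $\overline{\mathcal{E}}^R$ the category with the same objects and all (not necessarily degree-zero) module maps; let $\varphi:\mathcal{E}^R\to\overline{\mathcal{E}}^R$ be the forgetful functor. $\mathbf{K}^{p,q}_G$ is Karoubi's Grothendieck group of $\varphi$: it is generated by triples $(E,F,s)$ with $E,F$ objects of $\mathcal{E}^R$ and $s:\varphi E\to\varphi F$ an isomorphism, with sum given by direct sum, where triples $(E_0,F_0,s_0)$ and $(E_1,F_1,s_1)$ are identified if there are degree-zero isomorphisms $f:E_0\to E_1$, $g:F_0\to F_1$ and a continuous path of isomorphisms $\varphi E_0\to\varphi F_0$ from $s_0$ to $g^{-1}s_1f$, and where triples with $s$ of degree zero are set to zero. *)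

(* Defs.v *)
From HB Require Import structures.
From mathcomp Require Import all_boot all_order all_algebra all_fingroup.
From mathcomp Require Import boolp classical_sets reals.
From mathcomp Require Import complex.
From mathcomp Require Import topology normedtype trigo.

Set Implicit Arguments.
Unset Strict Implicit.
Unset Printing Implicit Defensive.

Import GRing.Theory Num.Theory numFieldNormedType.Exports.

Local Open Scope classical_set_scope.
Local Open Scope complex_scope.
Local Open Scope quotient_scope.
Local Open Scope ring_scope.

(* Not the [repr] of fingroup. *)
Local Notation repr := generic_quotient.repr.

(* The group law of ['Z_2] as a finGroupType is addition modulo 2. *)
Record magneticGroup := MagneticGroup {
  mg_group :> finGroupType;
  mg_phi : {morphism [set: mg_group]%SET >-> 'Z_2};
  _ : forall a : 'Z_2, exists g, mg_phi g = a }.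

Arguments mg_phi {m}.

Lemma mg_phi_surj (G : magneticGroup) (a : 'Z_2) :
  exists g : G, mg_phi g = a.
Proof. by case: G. Qed.

Lemma mg_phiM (G : magneticGroup) (g h : G) :
  mg_phi (g * h)%g = mg_phi g + mg_phi h :> 'Z_2.
Proof. by rewrite morphM ?inE. Qed.

Lemma mg_phi1 (G : magneticGroup) : mg_phi (1%g : G) = 0 :> 'Z_2.
Proof. exact: morph1. Qed.

Section Cohomology.
Context (R : realType) (G : magneticGroup).

Definition Kpow (a : 'Z_2) (z : R[i]) : R[i] := if a == 0 then z else conjc z.

(* Inhomogeneous 2-cocycles and 2-coboundaries of [G] with values in [C^*],
   where [g] acts by [Kpow (mg_phi g)]. *)
Definition cocycle2 (c : G -> G -> R[i]) : Prop :=
  (forall g h, c g h != 0) /\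
  forall g h k : G,
    Kpow (mg_phi g) (c h k) * c g (h * k)%g = c (g * h)%g k * c g h.

Definition coboundary2 (c : G -> G -> R[i]) : Prop :=
  exists2 lam : G -> R[i], (forall g, lam g != 0) &
    forall g h : G,
      c g h = lam g * Kpow (mg_phi g) (lam h) / lam (g * h)%g.

(* Equality of the classes of two cocycles in [H^2(G, C^*_phi)]. *)
Definition same_H2_class (c c' : G -> G -> R[i]) : Prop :=
  coboundary2 (fun g h => c g h / c' g h).

Definition expi (x : R) : R[i] := cos x +i* sin x.

Definition sigma (a b : 'Z_2) : R[i] := expi (pi * (a * b)%N%:R).

Definition phi_sigma (g h : G) : R[i] := sigma (mg_phi g) (mg_phi h).

Lemma sigmaE (a b : 'Z_2) : sigma a b = (-1) ^+ (a * b)%N.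
Proof.
rewrite /sigma /expi; case: a b => [[|[|a]] // ?] [[|[|b]] // ?] /=.
- by rewrite muln0 mulr0 cos0 sin0 expr0.
- by rewrite mul0n mulr0 cos0 sin0 expr0.
- by rewrite muln0 mulr0 cos0 sin0 expr0.
rewrite muln1 mulr1 cospi sinpi expr1.
by apply/eqP; rewrite eq_complex /= oppr0 !eqxx.
Qed.

Lemma cocycle2_phi_sigma : cocycle2 phi_sigma.
Proof.
split=> [g h|g h k]; rewrite /phi_sigma !sigmaE ?expf_neq0 ?oppr_eq0 ?oner_eq0 //.
rewrite !mg_phiM.
move: (mg_phi g : 'Z_2) (mg_phi h : 'Z_2) (mg_phi k : 'Z_2) => {g h k}.
have KE a n : Kpow a ((-1) ^+ n) = (-1) ^+ n.
  by rewrite /Kpow; case: ifP => // _; rewrite rmorphXn rmorphN1.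
move=> a b c; rewrite !KE -!exprD -signr_odd -[RHS]signr_odd.
by move: a b c => [[|[|a]] // ?] [[|[|b]] // ?] [[|[|c]] // ?].
Qed.

End Cohomology.

Arguments phi_sigma : clear implicits.

(* The real Clifford algebra [C^{p,q}], presented by generators and relations:
   the quotient of the terms built from real scalars and the generators [e_j]
   by the least congruence containing the axioms of unital associative
   R-algebras and the Clifford relations.  Negation is multiplication by the
   scalar -1.  With indices starting at 0, [e_j] squares to 1 iff [j < p]. *)
Section Clifford.
Context (R : realType) (p q : nat).

Inductive cl_term : Type :=
| ClScal of R
| ClGen of 'I_(p + q)
| ClAdd of cl_term & cl_term
| ClMul of cl_term & cl_term.

HB.instance Definition _ := gen_eqMixin cl_term.
HB.instance Definition _ := gen_choiceMixin cl_term.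

Inductive cl_eq : cl_term -> cl_term -> Prop :=
| cl_refl x : cl_eq x x
| cl_sym x y : cl_eq x y -> cl_eq y x
| cl_trans y x z : cl_eq x y -> cl_eq y z -> cl_eq x z
| cl_congrD x x' y y' : cl_eq x x' -> cl_eq y y' ->
    cl_eq (ClAdd x y) (ClAdd x' y')
| cl_congrM x x' y y' : cl_eq x x' -> cl_eq y y' ->
    cl_eq (ClMul x y) (ClMul x' y')
| cl_addA x y z : cl_eq (ClAdd x (ClAdd y z)) (ClAdd (ClAdd x y) z)
| cl_addC x y : cl_eq (ClAdd x y) (ClAdd y x)
| cl_add0 x : cl_eq (ClAdd (ClScal 0) x) x
| cl_addN x : cl_eq (ClAdd (ClMul (ClScal (-1)) x) x) (ClScal 0)
| cl_mulA x y z : cl_eq (ClMul x (ClMul y z)) (ClMul (ClMul x y) z)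
| cl_mul1 x : cl_eq (ClMul (ClScal 1) x) x
| cl_mulDl x y z : cl_eq (ClMul (ClAdd x y) z) (ClAdd (ClMul x z) (ClMul y z))
| cl_mulDr x y z : cl_eq (ClMul x (ClAdd y z)) (ClAdd (ClMul x y) (ClMul x z))
| cl_scalD a b : cl_eq (ClScal (a + b)) (ClAdd (ClScal a) (ClScal b))
| cl_scalM a b : cl_eq (ClScal (a * b)) (ClMul (ClScal a) (ClScal b))
| cl_scalC a x : cl_eq (ClMul (ClScal a) x) (ClMul x (ClScal a))
| cl_anticomm i j : i != j ->
    cl_eq (ClMul (ClGen i) (ClGen j))
          (ClMul (ClScal (-1)) (ClMul (ClGen j) (ClGen i)))
| cl_square (j : 'I_(p + q)) :
    cl_eq (ClMul (ClGen j) (ClGen j)) (ClScal (if (j < p)%N then 1 else -1)).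

Definition cl_eqb (x y : cl_term) : bool := `[< cl_eq x y >].

Lemma cl_eqb_refl : reflexive cl_eqb.
Proof. by move=> x; apply/asboolP; exact: cl_refl. Qed.

Lemma cl_eqb_sym : symmetric cl_eqb.
Proof.
by move=> x y; apply/idP/idP => /asboolP h; apply/asboolP; exact: cl_sym.
Qed.

Lemma cl_eqb_trans : transitive cl_eqb.
Proof.
by move=> y x z /asboolP xy /asboolP yz; apply/asboolP; exact: cl_trans xy yz.
Qed.

Canonical cl_equiv := EquivRel cl_eqb cl_eqb_refl cl_eqb_sym cl_eqb_trans.

Definition clifford : Type := {eq_quot cl_equiv}.
HB.instance Definition _ := Choice.on clifford.
HB.instance Definition _ := EqQuotient.on clifford.

Definition cl_class (x : cl_term) : clifford := \pi x.

Lemma cl_classP (x y : cl_term) : cl_class x = cl_class y <-> cl_eq x y.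
Proof.
split=> [/eqmodP|h]; first by move=> /asboolP.
by apply/eqmodP/asboolP.
Qed.

Lemma cl_repr (x : cl_term) : cl_eq (repr (cl_class x)) x.
Proof. by apply/cl_classP; rewrite /cl_class reprK. Qed.

Lemma cl_ind (P : clifford -> Prop) :
  (forall x, P (cl_class x)) -> forall x, P x.
Proof. by move=> h x; rewrite -[x]reprK; exact: h. Qed.

Definition cl_scal (a : R) : clifford := cl_class (ClScal a).
Definition cl_gen (j : 'I_(p + q)) : clifford := cl_class (ClGen j).
Definition cl_add (x y : clifford) := cl_class (ClAdd (repr x) (repr y)).
Definition cl_mul (x y : clifford) := cl_class (ClMul (repr x) (repr y)).
Definition cl_opp (x : clifford) := cl_mul (cl_scal (-1)) x.

Lemma cl_class_add x y :
  cl_add (cl_class x) (cl_class y) = cl_class (ClAdd x y).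
Proof. by apply/cl_classP; apply: cl_congrD; exact: cl_repr. Qed.

Lemma cl_class_mul x y :
  cl_mul (cl_class x) (cl_class y) = cl_class (ClMul x y).
Proof. by apply/cl_classP; apply: cl_congrM; exact: cl_repr. Qed.

Fact cl_quot_addA : associative cl_add.
Proof.
elim/cl_ind=> x; elim/cl_ind=> y; elim/cl_ind=> z.
by rewrite !cl_class_add; apply/cl_classP; exact: cl_addA.
Qed.

Fact cl_quot_addC : commutative cl_add.
Proof.
elim/cl_ind=> x; elim/cl_ind=> y.
by rewrite !cl_class_add; apply/cl_classP; exact: cl_addC.
Qed.

Fact cl_quot_add0 : left_id (cl_scal 0) cl_add.
Proof.
by elim/cl_ind=> x; rewrite cl_class_add; apply/cl_classP; exact: cl_add0.
Qed.

Fact cl_quot_addN : left_inverse (cl_scal 0) cl_opp cl_add.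
Proof.
elim/cl_ind=> x; rewrite /cl_opp cl_class_mul cl_class_add.
by apply/cl_classP; exact: cl_addN.
Qed.

HB.instance Definition _ := GRing.isZmodule.Build clifford
  cl_quot_addA cl_quot_addC cl_quot_add0 cl_quot_addN.

Fact cl_quot_mulA : associative cl_mul.
Proof.
elim/cl_ind=> x; elim/cl_ind=> y; elim/cl_ind=> z.
by rewrite !cl_class_mul; apply/cl_classP; exact: cl_mulA.
Qed.

Fact cl_quot_mul1 : left_id (cl_scal 1) cl_mul.
Proof.
by elim/cl_ind=> x; rewrite cl_class_mul; apply/cl_classP; exact: cl_mul1.
Qed.

Fact cl_quot_mulr1 : right_id (cl_scal 1) cl_mul.
Proof.
elim/cl_ind=> x; rewrite cl_class_mul; apply/cl_classP.
by apply: cl_trans (cl_mul1 x); apply: cl_sym; exact: cl_scalC.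
Qed.

Fact cl_quot_mulDl : left_distributive cl_mul cl_add.
Proof.
elim/cl_ind=> x; elim/cl_ind=> y; elim/cl_ind=> z.
by rewrite !(cl_class_mul, cl_class_add); apply/cl_classP; exact: cl_mulDl.
Qed.

Fact cl_quot_mulDr : right_distributive cl_mul cl_add.
Proof.
elim/cl_ind=> x; elim/cl_ind=> y; elim/cl_ind=> z.
by rewrite !(cl_class_mul, cl_class_add); apply/cl_classP; exact: cl_mulDr.
Qed.

HB.instance Definition _ := GRing.Zmodule_isPzRing.Build clifford
  cl_quot_mulA cl_quot_mul1 cl_quot_mulr1 cl_quot_mulDl cl_quot_mulDr.

Lemma cl_addE x y : cl_class x + cl_class y = cl_class (ClAdd x y).
Proof. exact: cl_class_add. Qed.

Lemma cl_mulE x y : cl_class x * cl_class y = cl_class (ClMul x y).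
Proof. exact: cl_class_mul. Qed.

Lemma cl_scal0 : cl_scal 0 = 0. Proof. by []. Qed.
Lemma cl_scal1 : cl_scal 1 = 1. Proof. by []. Qed.

Lemma cl_quot_scalD a b : cl_scal (a + b) = cl_scal a + cl_scal b.
Proof. by rewrite cl_addE; apply/cl_classP; exact: cl_scalD. Qed.

Lemma cl_quot_scalM a b : cl_scal (a * b) = cl_scal a * cl_scal b.
Proof. by rewrite cl_mulE; apply/cl_classP; exact: cl_scalM. Qed.

Lemma cl_quot_scalC a x : cl_scal a * x = x * cl_scal a.
Proof.
by elim/cl_ind: x => x; rewrite !cl_mulE; apply/cl_classP; exact: cl_scalC.
Qed.

Lemma cl_scalN1 x : cl_scal (-1) * x = - x.
Proof. by []. Qed.

Lemma cl_gen_anticomm i j : i != j -> cl_gen i * cl_gen j = - (cl_gen j * cl_gen i).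
Proof.
by move=> ij; rewrite -cl_scalN1 (cl_mulE (ClGen j)) !cl_mulE; apply/cl_classP;
  exact: cl_anticomm.
Qed.

Lemma cl_gen_square (j : 'I_(p + q)) :
  cl_gen j * cl_gen j = if (j < p)%N then 1 else -1.
Proof.
have -> : (if (j < p)%N then 1 else -1) = cl_scal (if (j < p)%N then 1 else -1).
  by case: ifP => // _; rewrite -cl_scalN1 mulr1.
by rewrite cl_mulE; apply/cl_classP; exact: cl_square.
Qed.

(* The homogeneous components: sums of real multiples of products of
   generators, with the number of generators congruent to the degree modulo
   2. *)
Inductive cl_homog : 'Z_2 -> clifford -> Prop :=
| cl_homog0 i : cl_homog i 0
| cl_homog_scal a : cl_homog 0 (cl_scal a)
| cl_homog_gen j : cl_homog 1 (cl_gen j)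
| cl_homogD i x y : cl_homog i x -> cl_homog i y -> cl_homog i (x + y)
| cl_homogM i j x y : cl_homog i x -> cl_homog j y -> cl_homog (i + j) (x * y).

(* The complexification [C^{p,q} (x)_R C = C^{p,q} (+) C^{p,q} i]: the pair
   [(x, y)] is [x (x) 1 + y (x) i]. *)
Definition ccliff : Type := (clifford * clifford)%type.
HB.instance Definition _ := GRing.Zmodule.copy ccliff (clifford * clifford)%type.

Definition ccl_mul (x y : ccliff) : ccliff :=
  (x.1 * y.1 - x.2 * y.2, x.1 * y.2 + x.2 * y.1).

Fact ccl_mulA : associative ccl_mul.
Proof.
move=> [x x'] [y y'] [z z']; congr pair => /=;
  rewrite !(mulrDr, mulrDl, mulrN, mulNr, mulrA, opprD).
  by rewrite -!addrA; congr (_ + _); rewrite addrA addrC.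
rewrite -!addrA; congr (_ + _).
by rewrite [RHS]addrC -!addrA; congr (_ + _); rewrite addrC.
Qed.

Fact ccl_mul1 : left_id ((1, 0) : ccliff) ccl_mul.
Proof. by move=> [x y]; rewrite /ccl_mul /= !(mul1r, mul0r, subr0, addr0). Qed.

Fact ccl_mulr1 : right_id ((1, 0) : ccliff) ccl_mul.
Proof.
by move=> [x y]; rewrite /ccl_mul /= !(mulr1, mulr0, subr0, add0r).
Qed.

Fact ccl_mulDl : left_distributive ccl_mul +%R.
Proof.
move=> [x x'] [y y'] [z z']; congr pair => /=;
  by rewrite !(mulrDr, mulrDl, opprD) addrACA.
Qed.

Fact ccl_mulDr : right_distributive ccl_mul +%R.
Proof.
move=> [x x'] [y y'] [z z']; congr pair => /=;
  by rewrite !(mulrDr, mulrDl, opprD) addrACA.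
Qed.

HB.instance Definition _ := GRing.Zmodule_isPzRing.Build ccliff
  ccl_mulA ccl_mul1 ccl_mulr1 ccl_mulDl ccl_mulDr.

Definition ccl_scal (z : R[i]) : ccliff :=
  (cl_scal (complex.Re z), cl_scal (complex.Im z)).

Definition ccl_homog (i : 'Z_2) (x : ccliff) : Prop :=
  cl_homog i x.1 /\ cl_homog i x.2.

(* [id (x) K^a] *)
Definition ccl_Kpow (a : 'Z_2) (x : ccliff) : ccliff :=
  if a == 0 then x else (x.1, - x.2).

Lemma ccl_Kpow_add a : {morph ccl_Kpow a : x y / x + y}.
Proof.
move=> [x x'] [y y']; rewrite /ccl_Kpow; case: ifP => // _.
by congr pair; exact: opprD.
 Qed.

Lemma ccl_Kpow0 a : ccl_Kpow a 0 = 0.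
Proof. by rewrite /ccl_Kpow; case: ifP => // _; congr pair; exact: oppr0. Qed.

Lemma ccl_Kpow_mul a : {morph ccl_Kpow a : x y / x * y}.
Proof.
move=> [x x'] [y y']; rewrite /ccl_Kpow; case: ifP => // _; congr pair => /=.
  by rewrite mulrNN.
by rewrite opprD mulrN mulNr.
Qed.

Lemma ccl_Kpow1 a : ccl_Kpow a 1 = 1.
Proof. by rewrite /ccl_Kpow; case: ifP => // _; congr pair; exact: oppr0. Qed.

Lemma ccl_Kpow_comp a b x : ccl_Kpow a (ccl_Kpow b x) = ccl_Kpow (a + b) x.
Proof.
case: x => x y; rewrite /ccl_Kpow.
by case: a b => [[|[|a]] // ?] [[|[|b]] // ?] //=; rewrite opprK.
Qed.

End Clifford.

Section TwistedGroupAlgebra.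
Context (R : realType) (G : magneticGroup) (p q : nat).

(* [C^{p,q}_C[G]]: the function [x] is the sum over [g] of the symbols
   [|_x g, g_|]. *)
Definition magalg : Type := {ffun G -> ccliff R p q}.
HB.instance Definition _ := GRing.Zmodule.copy magalg {ffun G -> ccliff R p q}.

Definition symb (a : ccliff R p q) (g : G) : magalg :=
  [ffun k => if k == g then a else 0].

Definition magalg_mul (x y : magalg) : magalg :=
  [ffun k => \sum_(g : G) x g * ccl_Kpow (mg_phi g) (y (g^-1 * k)%g)].

Lemma ccl_Kpow_sum a (I : Type) (r : seq I) (F : I -> ccliff R p q) :
  ccl_Kpow a (\sum_(i <- r) F i) = \sum_(i <- r) ccl_Kpow a (F i).
Proof.
exact: (big_morph (ccl_Kpow a) (@ccl_Kpow_add _ _ _ a) (@ccl_Kpow0 _ _ _ a)).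
Qed.

Fact magalg_mulA : associative magalg_mul.
Proof.
move=> x y z; apply/ffunP => k; rewrite !ffunE.
under eq_bigr => g _ do rewrite ffunE ccl_Kpow_sum mulr_sumr.
under [RHS]eq_bigr => g _ do rewrite ffunE mulr_suml.
rewrite [RHS]exchange_big /=; apply: eq_bigr => g _.
rewrite [RHS](reindex_inj (mulgI g)) /=; apply: eq_bigr => h _.
rewrite ccl_Kpow_mul ccl_Kpow_comp mulrA mulKg -mg_phiM.
by rewrite invMg mulgA.
Qed.

Fact magalg_mul1 : left_id (symb 1 1%g) magalg_mul.
Proof.
move=> x; apply/ffunP => k; rewrite !ffunE (bigD1 1%g) //= big1 => [|g /negPf g1].
  by rewrite ffunE eqxx mul1r addr0 mg_phi1 invg1 mul1g /ccl_Kpow eqxx.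
by rewrite ffunE g1 mul0r.
Qed.

Fact magalg_mulr1 : right_id (symb 1 1%g) magalg_mul.
Proof.
move=> x; apply/ffunP => k; rewrite !ffunE (bigD1 k) //= big1 => [|g gk].
  by rewrite ffunE mulVg eqxx ccl_Kpow1 mulr1 addr0.
rewrite ffunE; case: eqP => [gk1|_]; last by rewrite ccl_Kpow0 mulr0.
by move: gk; rewrite -[X in X != _]mulg1 -gk1 mulKVg eqxx.
Qed.

Fact magalg_mulDl : left_distributive magalg_mul +%R.
Proof.
move=> x y z; apply/ffunP => k; rewrite !ffunE -big_split /=.
by apply: eq_bigr => g _; rewrite ffunE mulrDl.
Qed.

Fact magalg_mulDr : right_distributive magalg_mul +%R.
Proof.
move=> x y z; apply/ffunP => k; rewrite !ffunE -big_split /=.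
by apply: eq_bigr => g _; rewrite ffunE ccl_Kpow_add mulrDr.
Qed.

HB.instance Definition _ := GRing.Zmodule_isPzRing.Build magalg
  magalg_mulA magalg_mul1 magalg_mulr1 magalg_mulDl magalg_mulDr.

Lemma magalg_sum_symb (x : magalg) : x = \sum_(g : G) symb (x g) g.
Proof.
apply/ffunP => k; rewrite sum_ffunE (bigD1 k) //= big1 => [|g gk].
  by rewrite ffunE eqxx addr0.
by rewrite ffunE eq_sym (negPf gk).
Qed.

Lemma symbD a b g : symb (a + b) g = symb a g + symb b g.
Proof. by apply/ffunP => k; rewrite !ffunE; case: ifP; rewrite ?addr0. Qed.

Lemma symbM a b (g h : G) :
  symb a g * symb b h = symb (a * ccl_Kpow (mg_phi g) b) (g * h)%g.
Proof.
apply/ffunP => k; rewrite !ffunE (bigD1 g) //= big1 => [|g' /negPf g'g]; last first.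
  by rewrite ffunE g'g mul0r.
rewrite !ffunE eqxx addr0.
have -> : (g^-1 * k == h)%g = (k == g * h)%g.
  by rewrite -(inj_eq (mulgI g)) mulKVg.
by case: ifP => // _; rewrite ccl_Kpow0 mulr0.
Qed.

Definition magalg_scal (z : R[i]) : magalg := symb (ccl_scal p q z) 1%g.

Definition magalg_homog (i : 'Z_2) (x : magalg) : Prop :=
  forall g, ccl_homog i (x g).

End TwistedGroupAlgebra.

Section GradedModules.
Context (R : realType) (G : magneticGroup) (p q : nat).
Local Notation A := (magalg R G p q).

(* Finite-dimensional graded complex [A]-modules, up to isomorphism: the
   underlying complex vector space is [C^n], on which the complex scalars of
   [A] act as usual; lemma [gmod_transport] below moves any finite-dimensional
   graded module to this form.  The fields [gm_actA] to [gm_actDl] are the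
   axioms of [lmodType A], which is then the structure put on the carrier.
   The components are complex subspaces because the scalars have degree 0. *)
Record gmod := Gmod {
  gm_dim : nat;
  gm_act : A -> 'rV[R[i]]_gm_dim -> 'rV[R[i]]_gm_dim;
  gm_actA : forall a b v, gm_act a (gm_act b v) = gm_act (a * b) v;
  gm_act1 : left_id 1 gm_act;
  gm_actDr : right_distributive gm_act +%R;
  gm_actDl : forall v, {morph gm_act^~ v : a b / a + b};
  gm_act_scal : forall z v, gm_act (magalg_scal G p q z) v = z *: v;
  gm_hom : 'Z_2 -> set 'rV[R[i]]_gm_dim;
  gm_hom0 : forall i, gm_hom i 0;
  gm_homB : forall i v w, gm_hom i v -> gm_hom i w -> gm_hom i (v - w);
  gm_hom_dec : forall v, exists! w : 'rV[R[i]]_gm_dim * 'rV[R[i]]_gm_dim,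
    [/\ gm_hom 0 w.1, gm_hom 1 w.2 & v = w.1 + w.2];
  gm_hom_act : forall i j a v,
    magalg_homog i a -> gm_hom j v -> gm_hom (i + j) (gm_act a v) }.

Definition gm_carrier (E : gmod) : Type := 'rV[R[i]]_(gm_dim E).
Coercion gm_carrier : gmod >-> Sortclass.

HB.instance Definition _ (E : gmod) :=
  GRing.Zmodule.copy (gm_carrier E) 'rV[R[i]]_(gm_dim E).
HB.instance Definition _ (E : gmod) :=
  GRing.Zmodule_isLmodule.Build A (gm_carrier E)
    (@gm_actA E) (@gm_act1 E) (@gm_actDr E) (@gm_actDl E).

Lemma gm_linear_act (E F : gmod) (f : {linear E -> F}) (a : A) (v : E) :
  f (gm_act a v : E) = gm_act a (f v : 'rV_(gm_dim F)).
Proof. exact: linearZ. Qed.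

Definition degree0 (E F : gmod) (f : E -> F) : Prop :=
  forall i v, gm_hom i v -> gm_hom i (f v : 'rV_(gm_dim F)).

(* A homotopy in [Hom_A(E, F)] with its topology of a finite-dimensional
   complex vector space, which is that of pointwise convergence. *)
Definition continuous_path (E F : gmod) (s : R -> {linear E -> F}) : Prop :=
  forall v : E, {within `[0 : R, 1 : R], continuous
    (fun t : R => (s t v : 'rV[R[i]^o]_(gm_dim F)))}.

Section DirectSum.
Variables E F : gmod.
Let n := gm_dim E.
Let m := gm_dim F.

Definition dsum_act (a : A) (v : 'rV[R[i]]_(n + m)) : 'rV[R[i]]_(n + m) :=
  row_mx (gm_act a (lsubmx v)) (gm_act a (rsubmx v)).

Definition dsum_hom (i : 'Z_2) : set 'rV[R[i]]_(n + m) :=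
  [set v | gm_hom i (lsubmx v) /\ gm_hom i (rsubmx v)].

Fact dsum_actA a b v : dsum_act a (dsum_act b v) = dsum_act (a * b) v.
Proof. by rewrite /dsum_act row_mxKl row_mxKr !gm_actA. Qed.

Fact dsum_act1 : left_id 1 dsum_act.
Proof. by move=> v; rewrite /dsum_act !gm_act1 hsubmxK. Qed.

Fact dsum_actDr : right_distributive dsum_act +%R.
Proof. by move=> a v w; rewrite /dsum_act !raddfD !gm_actDr add_row_mx. Qed.

Fact dsum_actDl v : {morph dsum_act^~ v : a b / a + b}.
Proof. by move=> a b; rewrite /dsum_act !gm_actDl add_row_mx. Qed.

Fact dsum_act_scal z v : dsum_act (magalg_scal G p q z) v = z *: v.
Proof. by rewrite /dsum_act !gm_act_scal -scale_row_mx hsubmxK. Qed.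

Fact dsum_hom0 i : dsum_hom i 0.
Proof. by split; rewrite raddf0; exact: gm_hom0. Qed.

Fact dsum_homB i v w : dsum_hom i v -> dsum_hom i w -> dsum_hom i (v - w).
Proof. by move=> [? ?] [? ?]; split; rewrite raddfB; exact: gm_homB. Qed.

Fact dsum_hom_dec v : exists! w : 'rV[R[i]]_(n + m) * 'rV[R[i]]_(n + m),
  [/\ dsum_hom 0 w.1, dsum_hom 1 w.2 & v = w.1 + w.2].
Proof.
have [[a b] /= [[a0 b1 vab] uab]] := gm_hom_dec (lsubmx v).
have [[c d] /= [[c0 d1 vcd] ucd]] := gm_hom_dec (rsubmx v).
exists (row_mx a c, row_mx b d); split=> /=.
  rewrite /dsum_hom /= !row_mxKl !row_mxKr; split=> //.
  by rewrite add_row_mx -vab -vcd hsubmxK.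
move=> [x y] /= [[x0 x0'] [y1 y1'] vE].
have [] : (a, b) = (lsubmx x, lsubmx y) by apply: uab; rewrite vE raddfD.
have [] : (c, d) = (rsubmx x, rsubmx y) by apply: ucd; rewrite vE raddfD.
by move=> -> -> -> ->; rewrite !hsubmxK.
Qed.

Fact dsum_hom_act i j a v :
  magalg_homog i a -> dsum_hom j v -> dsum_hom (i + j) (dsum_act a v).
Proof.
move=> ai [vl vr]; rewrite /dsum_hom /dsum_act /= row_mxKl row_mxKr.
by split; exact: gm_hom_act.
Qed.

Definition dsum : gmod := Gmod dsum_actA dsum_act1 dsum_actDr dsum_actDl
  dsum_act_scal dsum_hom0 dsum_homB dsum_hom_dec dsum_hom_act.

End DirectSum.

Section DirectSumMap.
Variables (E E' F F' : gmod) (s : {linear E -> F}) (s' : {linear E' -> F'}).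

Definition dsum_map (v : dsum E E') : dsum F F' :=
  row_mx (s (lsubmx (v : 'rV_(gm_dim E + gm_dim E'))))
         (s' (rsubmx (v : 'rV_(gm_dim E + gm_dim E')))).

Fact dsum_map_linear : linear dsum_map.
Proof.
move=> a v w; rewrite /dsum_map.
have lE : lsubmx (a *: v : 'rV_(gm_dim E + gm_dim E')) =
    gm_act a (lsubmx (v : 'rV_(gm_dim E + gm_dim E'))) by exact: row_mxKl.
have rE : rsubmx (a *: v : 'rV_(gm_dim E + gm_dim E')) =
    gm_act a (rsubmx (v : 'rV_(gm_dim E + gm_dim E'))) by exact: row_mxKr.
rewrite !raddfD /= lE rE !gm_linear_act.
rewrite [RHS]/(dsum_act a _ + _) /dsum_act row_mxKl row_mxKr.
by rewrite [RHS]add_row_mx.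
Qed.

HB.instance Definition _ :=
  GRing.isLinear.Build A (dsum E E') (dsum F F') *:%R dsum_map dsum_map_linear.

Lemma dsum_map_bij : bijective s -> bijective s' -> bijective dsum_map.
Proof.
move=> [t ts st] [t' ts' st'].
exists (fun v : 'rV_(gm_dim F + gm_dim F') =>
  row_mx (t (lsubmx v)) (t' (rsubmx v))) => v.
  by rewrite /dsum_map row_mxKl row_mxKr ts ts' hsubmxK.
by rewrite /dsum_map row_mxKl row_mxKr st st' hsubmxK.
Qed.

End DirectSumMap.

Section Transport.
Variables (V : lmodType A) (hom : 'Z_2 -> set V) (n : nat).
Variables (f : {additive V -> 'rV[R[i]]_n}).

Lemma gmod_transport :
    (forall i, hom i 0) ->
    (forall i v w, hom i v -> hom i w -> hom i (v - w)) ->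
    (forall v, exists! w : V * V, [/\ hom 0 w.1, hom 1 w.2 & v = w.1 + w.2]) ->
    (forall i j a v, magalg_homog i a -> hom j v -> hom (i + j) (a *: v)) ->
    bijective f ->
    (forall z v, f (magalg_scal G p q z *: v) = z *: f v) ->
  exists E : gmod, exists g : {linear V -> E},
    bijective g /\ forall i v, hom i v <-> gm_hom i (g v : 'rV_(gm_dim E)).
Proof.
move=> h0 hB hdec hact [f' f'K fK] fZ.
have f'D : {morph f' : x y / x + y}.
  by move=> x y; apply: (can_inj f'K); rewrite fK raddfD !fK.
have f'B : {morph f' : x y / x - y}.
  by move=> x y; apply: (can_inj f'K); rewrite fK raddfB !fK.
have f'0 : f' 0 = 0 by apply: (can_inj f'K); rewrite fK raddf0.
pose act (a : A) x := f (a *: f' x).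
have actA a b v : act a (act b v) = act (a * b) v.
  by rewrite /act f'K scalerA.
have act1 : left_id 1 act by move=> v; rewrite /act scale1r fK.
have actDr : right_distributive act +%R.
  by move=> a v w; rewrite /act f'D scalerDr raddfD.
have actDl v : {morph act^~ v : a b / a + b}.
  by move=> a b; rewrite /act scalerDl raddfD.
have act_scal z v : act (magalg_scal G p q z) v = z *: v.
  by rewrite /act fZ fK.
pose hom' i : set 'rV[R[i]]_n := [set x | hom i (f' x)].
have hom0 i : hom' i 0 by rewrite /hom' /= f'0.
have homB i v w : hom' i v -> hom' i w -> hom' i (v - w).
  by rewrite /hom' /= f'B; exact: hB.
have hom_dec v : exists! w : 'rV[R[i]]_n * 'rV[R[i]]_n,
    [/\ hom' 0 w.1, hom' 1 w.2 & v = w.1 + w.2].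
  have [[x y] /= [[x0 y1 vE] u]] := hdec (f' v).
  exists (f x, f y); split=> /=.
    by rewrite /hom' /= !f'K; split=> //; rewrite -raddfD -vE fK.
  move=> [x' y'] /= [x'0 y'1 v'E].
  have [-> ->] : (x, y) = (f' x', f' y') by apply: u; rewrite v'E f'D.
  by rewrite !fK.
have hom_act i j a v :
    magalg_homog i a -> hom' j v -> hom' (i + j) (act a v).
  by rewrite /hom' /act /= f'K; exact: hact.
pose E := Gmod actA act1 actDr actDl act_scal hom0 homB hom_dec hom_act.
pose g (v : V) : E := f v.
have g_lin : linear g.
  move=> a v w; rewrite /g raddfD; congr (_ + _).
  by rewrite -[in LHS](f'K v).
pose gL := GRing.isLinear.Build A V E *:%R g g_lin.
pose gg : {linear V -> E} := HB.pack g gL.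
exists E, gg; split; first by exists f'.
by move=> i v; rewrite /= /hom' /= /g f'K.
Qed.

End Transport.

End GradedModules.

Section Karoubi.
Context (R : realType) (G : magneticGroup) (p q : nat).
Local Notation gmod := (gmod R G p q).

Record triple := Triple {
  tr_src : gmod;
  tr_tgt : gmod;
  tr_map : {linear tr_src -> tr_tgt};
  tr_bij : bijective tr_map }.

Definition tr_sum (T T' : triple) : triple :=
  Triple (dsum_map_bij (tr_bij T) (tr_bij T')).

Definition tr_equiv (T0 T1 : triple) : Prop :=
  exists (f : {linear tr_src T0 -> tr_src T1})
         (g : {linear tr_tgt T0 -> tr_tgt T1})
         (s : R -> {linear tr_src T0 -> tr_tgt T0}),
  [/\ bijective f /\ degree0 f,
      bijective g /\ degree0 g,
      continuous_path s /\ (forall t, 0 <= t <= 1 -> bijective (s t)),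
      s 0 =1 tr_map T0 &
      g \o s 1 =1 tr_map T1 \o f].

(* The abelian group generated by the triples, subject to the relations
   [kg_rel_equiv], [kg_rel_sum] and [kg_rel_degree0]: formal expressions
   modulo the least congruence containing these and the axioms of abelian
   groups. *)
Inductive kg_term : Type :=
| KgZero
| KgGen of triple
| KgAdd of kg_term & kg_term
| KgOpp of kg_term.

HB.instance Definition _ := gen_eqMixin kg_term.
HB.instance Definition _ := gen_choiceMixin kg_term.

Inductive kg_eq : kg_term -> kg_term -> Prop :=
| kg_refl x : kg_eq x x
| kg_sym x y : kg_eq x y -> kg_eq y x
| kg_trans y x z : kg_eq x y -> kg_eq y z -> kg_eq x z
| kg_congrD x x' y y' : kg_eq x x' -> kg_eq y y' ->
    kg_eq (KgAdd x y) (KgAdd x' y')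
| kg_congrN x x' : kg_eq x x' -> kg_eq (KgOpp x) (KgOpp x')
| kg_addA x y z : kg_eq (KgAdd x (KgAdd y z)) (KgAdd (KgAdd x y) z)
| kg_addC x y : kg_eq (KgAdd x y) (KgAdd y x)
| kg_add0 x : kg_eq (KgAdd KgZero x) x
| kg_addN x : kg_eq (KgAdd (KgOpp x) x) KgZero
| kg_rel_equiv T0 T1 : tr_equiv T0 T1 -> kg_eq (KgGen T0) (KgGen T1)
| kg_rel_sum T T' : kg_eq (KgGen (tr_sum T T')) (KgAdd (KgGen T) (KgGen T'))
| kg_rel_degree0 T : degree0 (tr_map T) -> kg_eq (KgGen T) KgZero.

Definition kg_eqb (x y : kg_term) : bool := `[< kg_eq x y >].

Lemma kg_eqb_refl : reflexive kg_eqb.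
Proof. by move=> x; apply/asboolP; exact: kg_refl. Qed.

Lemma kg_eqb_sym : symmetric kg_eqb.
Proof.
by move=> x y; apply/idP/idP => /asboolP h; apply/asboolP; exact: kg_sym.
Qed.

Lemma kg_eqb_trans : transitive kg_eqb.
Proof.
by move=> y x z /asboolP xy /asboolP yz; apply/asboolP; exact: kg_trans xy yz.
Qed.

Canonical kg_equiv := EquivRel kg_eqb kg_eqb_refl kg_eqb_sym kg_eqb_trans.

Definition KG : Type := {eq_quot kg_equiv}.
HB.instance Definition _ := Choice.on KG.
HB.instance Definition _ := EqQuotient.on KG.

Definition kg_class (x : kg_term) : KG := \pi x.

Lemma kg_classP (x y : kg_term) : kg_class x = kg_class y <-> kg_eq x y.
Proof.
split=> [/eqmodP|h]; first by move=> /asboolP.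
by apply/eqmodP/asboolP.
Qed.

Lemma kg_repr (x : kg_term) : kg_eq (repr (kg_class x)) x.
Proof. by apply/kg_classP; rewrite /kg_class reprK. Qed.

Lemma kg_ind (P : KG -> Prop) :
  (forall x, P (kg_class x)) -> forall x, P x.
Proof. by move=> h x; rewrite -[x]reprK; exact: h. Qed.

Definition kg_add (x y : KG) := kg_class (KgAdd (repr x) (repr y)).
Definition kg_opp (x : KG) := kg_class (KgOpp (repr x)).

Lemma kg_class_add x y :
  kg_add (kg_class x) (kg_class y) = kg_class (KgAdd x y).
Proof. by apply/kg_classP; apply: kg_congrD; exact: kg_repr. Qed.

Lemma kg_class_opp x : kg_opp (kg_class x) = kg_class (KgOpp x).
Proof. by apply/kg_classP; apply: kg_congrN; exact: kg_repr. Qed.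

Fact kg_quot_addA : associative kg_add.
Proof.
elim/kg_ind=> x; elim/kg_ind=> y; elim/kg_ind=> z.
by rewrite !kg_class_add; apply/kg_classP; exact: kg_addA.
Qed.

Fact kg_quot_addC : commutative kg_add.
Proof.
elim/kg_ind=> x; elim/kg_ind=> y.
by rewrite !kg_class_add; apply/kg_classP; exact: kg_addC.
Qed.

Fact kg_quot_add0 : left_id (kg_class KgZero) kg_add.
Proof.
by elim/kg_ind=> x; rewrite kg_class_add; apply/kg_classP; exact: kg_add0.
Qed.

Fact kg_quot_addN : left_inverse (kg_class KgZero) kg_opp kg_add.
Proof.
elim/kg_ind=> x; rewrite kg_class_opp kg_class_add.
by apply/kg_classP; exact: kg_addN.
Qed.

HB.instance Definition _ := GRing.isZmodule.Build KG
  kg_quot_addA kg_quot_addC kg_quot_add0 kg_quot_addN.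

End Karoubi.

(* Main.v *)
Require Import Defs.
From HB Require Import structures.
From mathcomp Require Import all_boot all_order all_algebra all_fingroup.
From mathcomp Require Import boolp classical_sets reals.
From mathcomp Require Import complex.
From mathcomp Require Import topology normedtype.

(** Let e1, .., e4 be the four extra generators of square -1.  Inside the
    algebra that they generate, I = e1 e2 and J = e2 e3 are even and span a
    copy of the quaternions, which commutes with the two odd anticommuting
    elements eps = - e1 e2 e3 and f = e4, of squares 1 and -1.  Over the complex
    numbers both factors are algebras of 2 x 2 matrices, so that a module E over
    the larger algebra is four copies of the subspace P on which I acts as the
    imaginary unit and A = - eps f as the identity: E is the sum of P, P eps,
    P J and P J eps.  The old generators and the grading preserve P.

    The only obstruction is an antilinear g: it conjugates the imaginary unit,
    hence carries P to P J.  Following g by the inverse of J brings it back to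
    P, but as J^2 = -1 the result represents G only up to the sign
    phi^* sigma.  The hypothesis says that this sign is the coboundary of some
    lam : G -> C^*, and dividing by lam gives an honest module P over the
    smaller algebra.  Conversely the four copies of a module over the smaller
    algebra carry the larger one, with Pauli matrices for the e_k and with
    lam g J^phi(g) in front of the action of g.

    Both constructions are functors which are complex linear on maps of modules
    and preserve the degree.  Hence they send paths of isomorphisms, direct sums
    and triples of degree zero to the same, and so induce homomorphisms of the
    Karoubi groups (KG_map).  They are inverse to each other up to natural
    isomorphisms of degree zero, and naturally isomorphic triples have the same
    class (KG_mapK).

    The computations are done with matrices.  A module on C^n amounts to the
    matrices of the generators, of the parity operator, and of the group
    elements composed with complex conjugation (gmod_of, ops_of), and the module
    maps are the intertwining matrices (is_hom_intertwines).  Matrices act on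
    row vectors from the right, so that a product of operators is written in
    reverse order.  The two constructions on operators are ext_ops and compress,
    and the isomorphisms between their composites and the identity are
    first_block, restricted to the corner, and spread. *)

Set Implicit Arguments.
Unset Strict Implicit.
Unset Printing Implicit Defensive.

Import GRing.Theory Num.Theory numFieldNormedType.Exports.

Local Open Scope classical_set_scope.
Local Open Scope complex_scope.
Local Open Scope ring_scope.

(** * Module maps as matrices *)

Lemma eq_mulmx_rV (T : comNzRingType) (m n : nat) (X Y : 'M[T]_(m, n)) :
  (forall v : 'rV_m, v *m X = v *m Y) -> X = Y.
Proof. by move=> h; apply/row_matrixP => i; rewrite !rowE. Qed.

Section ModuleMatrices.
Context (R : realType) (G : magneticGroup) (p q : nat).
Local Notation A := (magalg R G p q).
Local Notation gmod := (gmod R G p q).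

Section Pair.
Variables E F : gmod.
Implicit Type S : 'M[R[i]]_(gm_dim E, gm_dim F).

(** The complex scalars belong to the algebra, so a module map is complex linear
    and has a matrix; [lin_of] and [mx_of] pass between the two. *)
Definition is_hom S := forall (a : A) v, gm_act a v *m S = gm_act a (v *m S).

Definition is_deg0 S := forall i v, gm_hom i v -> gm_hom i (v *m S).

Section LinOf.
Variables (S : 'M[R[i]]_(gm_dim E, gm_dim F)) (homS : is_hom S).

Definition mx_fun (v : E) : F := (v : 'rV_(gm_dim E)) *m S.

Fact mx_fun_linear : linear mx_fun.
Proof.
by move=> a v w; rewrite /mx_fun mulmxDl; congr (_ + _); exact: homS.
Qed.

Definition lin_of : {linear E -> F} :=
  HB.pack mx_fun (GRing.isLinear.Build A E F *:%R mx_fun mx_fun_linear).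

End LinOf.

Definition mx_of (s : {linear E -> F}) : 'M[R[i]]_(gm_dim E, gm_dim F) :=
  lin1_mx (fun v : 'rV[R[i]]_(gm_dim E) => s v : 'rV[R[i]]_(gm_dim F)).

Lemma mul_mx_of (s : {linear E -> F}) (v : 'rV[R[i]]_(gm_dim E)) :
  v *m mx_of s = s v.
Proof.
pose f (v : 'rV[R[i]]_(gm_dim E)) : 'rV[R[i]]_(gm_dim F) := s v.
have f_lin : linear f.
  move=> z u w; rewrite /f [s _](raddfD s); congr (_ + _).
  by rewrite -!gm_act_scal; exact: gm_linear_act.
pose g : {linear 'rV[R[i]]_(gm_dim E) -> 'rV[R[i]]_(gm_dim F)} :=
  HB.pack f (GRing.isLinear.Build _ _ _ _ f f_lin).
exact: (mul_rV_lin1 g).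
Qed.

Lemma mx_of_hom (s : {linear E -> F}) : is_hom (mx_of s).
Proof. by move=> a v; rewrite !mul_mx_of; exact: gm_linear_act. Qed.

Lemma mx_of_deg0 (s : {linear E -> F}) : degree0 s -> is_deg0 (mx_of s).
Proof. by move=> s0 i v vi; rewrite mul_mx_of; exact: s0. Qed.

Lemma lin_ofK S (homS : is_hom S) : mx_of (lin_of homS) = S.
Proof. by apply: eq_mulmx_rV => v; rewrite mul_mx_of. Qed.

End Pair.

Definition mx_iso (E F : gmod) (S : 'M[R[i]]_(gm_dim E, gm_dim F)) : Prop :=
  exists S' : 'M[R[i]]_(gm_dim F, gm_dim E),
    S *m S' = 1%:M /\ S' *m S = 1%:M.

Lemma is_hom_inv (E F : gmod) (S : 'M_(gm_dim E, gm_dim F))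
    (S' : 'M_(gm_dim F, gm_dim E)) :
  is_hom S -> S *m S' = 1%:M -> S' *m S = 1%:M -> is_hom S'.
Proof.
move=> hS SS' S'S a v; rewrite -[v in LHS]mulmx1 -S'S mulmxA -hS.
by rewrite -mulmxA SS' mulmx1.
Qed.

Lemma lin_of_bij (E F : gmod) (S : 'M_(gm_dim E, gm_dim F)) (h : is_hom S) :
  mx_iso S -> bijective (lin_of h).
Proof.
move=> [S' [SS' S'S]].
exists (fun v : F => (v : 'rV_(gm_dim F)) *m S') => v.
  by rewrite /= /mx_fun -mulmxA SS' mulmx1.
by rewrite /= /mx_fun -mulmxA S'S mulmx1.
Qed.

Lemma mx_of_iso (E F : gmod) (s : {linear E -> F}) :
  bijective s -> mx_iso (mx_of s).
Proof.
move=> [t ts st].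
have t_lin : linear t.
  move=> a v w; apply: (can_inj ts); rewrite st raddfD /= linearZ /= !st //.
pose tt : {linear F -> E} :=
  HB.pack t (GRing.isLinear.Build A F E *:%R t t_lin).
exists (mx_of tt); split.
  by apply: eq_mulmx_rV => v; rewrite mulmxA !mul_mx_of mulmx1; exact: ts.
by apply: eq_mulmx_rV => v; rewrite mulmxA !mul_mx_of mulmx1; exact: st.
Qed.

Section DirectSumMatrices.
Variables E E' : gmod.
Let n := gm_dim E.
Let n' := gm_dim E'.
Local Notation D := (dsum E E').

Definition dsum_in1 : 'M[R[i]]_(gm_dim E, gm_dim D) := row_mx 1%:M 0.
Definition dsum_in2 : 'M[R[i]]_(gm_dim E', gm_dim D) := row_mx 0 1%:M.
Definition dsum_pr1 : 'M[R[i]]_(gm_dim D, gm_dim E) := col_mx 1%:M 0.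
Definition dsum_pr2 : 'M[R[i]]_(gm_dim D, gm_dim E') := col_mx 0 1%:M.

Lemma mul_dsum_in1 m (X : 'M_(m, n)) : X *m dsum_in1 = row_mx X 0.
Proof. by rewrite mul_mx_row mulmx1 mulmx0. Qed.
Lemma mul_dsum_in2 m (X : 'M_(m, n')) : X *m dsum_in2 = row_mx 0 X.
Proof. by rewrite mul_mx_row mulmx1 mulmx0. Qed.
Lemma mul_dsum_pr1 m (X : 'M_(m, n + n')) : X *m dsum_pr1 = lsubmx X.
Proof.
by rewrite -[X in X *m _]hsubmxK mul_row_col mulmx1 mulmx0 addr0.
Qed.
Lemma mul_dsum_pr2 m (X : 'M_(m, n + n')) : X *m dsum_pr2 = rsubmx X.
Proof.
by rewrite -[X in X *m _]hsubmxK mul_row_col mulmx1 mulmx0 add0r.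
Qed.

Fact gm_act0 (H : gmod) (a : A) : gm_act a (0 : 'rV_(gm_dim H)) = 0.
Proof. by apply: (addrI (gm_act a 0)); rewrite -gm_actDr !addr0. Qed.

Lemma dsum_in1_hom : is_hom dsum_in1.
Proof.
move=> a v; rewrite !mul_dsum_in1 /= /dsum_act row_mxKl row_mxKr.
by rewrite gm_act0.
Qed.
Lemma dsum_in2_hom : is_hom dsum_in2.
Proof.
move=> a v; rewrite !mul_dsum_in2 /= /dsum_act row_mxKl row_mxKr.
by rewrite gm_act0.
Qed.
Lemma dsum_pr1_hom : is_hom dsum_pr1.
Proof. by move=> a v; rewrite !mul_dsum_pr1 /= /dsum_act row_mxKl. Qed.
Lemma dsum_pr2_hom : is_hom dsum_pr2.
Proof. by move=> a v; rewrite !mul_dsum_pr2 /= /dsum_act row_mxKr. Qed.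

Lemma dsum_pr1_deg0 : is_deg0 dsum_pr1.
Proof. by move=> i v [vl _]; rewrite mul_dsum_pr1. Qed.
Lemma dsum_pr2_deg0 : is_deg0 dsum_pr2.
Proof. by move=> i v [_ vr]; rewrite mul_dsum_pr2. Qed.

Lemma dsum_pr_in :
  dsum_pr1 *m dsum_in1 + dsum_pr2 *m dsum_in2 = 1%:M.
Proof.
rewrite mul_dsum_in1 mul_dsum_in2 add_row_mx addr0 add0r.
by rewrite [RHS](scalar_mx_block n n') block_mxEh.
Qed.

Lemma dsum_in1_pr1 : dsum_in1 *m dsum_pr1 = 1%:M.
Proof. by rewrite mul_dsum_pr1 row_mxKl. Qed.
Lemma dsum_in1_pr2 : dsum_in1 *m dsum_pr2 = 0.
Proof. by rewrite mul_dsum_pr2 row_mxKr. Qed.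
Lemma dsum_in2_pr1 : dsum_in2 *m dsum_pr1 = 0.
Proof. by rewrite mul_dsum_pr1 row_mxKl. Qed.
Lemma dsum_in2_pr2 : dsum_in2 *m dsum_pr2 = 1%:M.
Proof. by rewrite mul_dsum_pr2 row_mxKr. Qed.

Lemma is_hom_row (H : gmod) (X : 'M_(gm_dim H, gm_dim E))
    (Y : 'M_(gm_dim H, gm_dim E')) :
  is_hom X -> is_hom Y -> is_hom (row_mx X Y : 'M_(gm_dim H, gm_dim D)).
Proof.
move=> hX hY a v; rewrite !mul_mx_row /= /dsum_act row_mxKl row_mxKr.
by rewrite hX hY.
Qed.

Lemma is_deg0_row (H : gmod) (X : 'M_(gm_dim H, gm_dim E))
    (Y : 'M_(gm_dim H, gm_dim E')) :
  is_deg0 X -> is_deg0 Y -> is_deg0 (row_mx X Y : 'M_(gm_dim H, gm_dim D)).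
Proof.
move=> hX hY i v vi; rewrite mul_mx_row /= /dsum_hom /= row_mxKl row_mxKr.
by split; [exact: hX|exact: hY].
Qed.

End DirectSumMatrices.

Lemma mx_of_dsum_map (E E' F F' : gmod)
    (s : {linear E -> F}) (s' : {linear E' -> F'}) :
  mx_of (dsum_map s s') = block_mx (mx_of s) 0 0 (mx_of s').
Proof.
apply: eq_mulmx_rV => v; rewrite mul_mx_of -[v in RHS]hsubmxK mul_row_block.
by rewrite !mulmx0 addr0 add0r !mul_mx_of.
Qed.

End ModuleMatrices.

Section Continuity.
Context (R : realType).
Local Notation C := R[i].

(** A neighbourhood of a matrix is given entrywise, and there are finitely many
    entries. *)
Lemma within_continuous_mx (T : topologicalType) (B : set T) (m n : nat)
    (f : T -> 'M[C^o]_(m, n)) :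
  (forall i j, {within B, continuous (fun t => f t i j : C^o)}) ->
  {within B, continuous f}.
Proof.
move=> fc t P [Q Qn QP].
apply: (filterS QP); apply: filter_forall => i; apply: filter_forall => j.
exact: (fc i j t _ (Qn i j)).
Qed.

(** The entries of [f t] are coordinates of the vectors [delta_mx 0 a *m f t],
    and those of [L (f t)] are linear combinations of them. *)
Lemma within_continuous_linear (T : topologicalType) (B : set T)
    (m n m' n' : nat) (f : T -> 'M[C]_(m, n))
    (L : 'M[C]_(m, n) -> 'M[C]_(m', n')) :
    linear L ->
    (forall v : 'rV_m,
      {within B, continuous (fun t => v *m f t : 'rV[C^o]_n)}) ->
  forall v : 'rV_m',
    {within B, continuous (fun t => v *m L (f t) : 'rV[C^o]_n')}.
Proof.
move=> L_lin fc v; apply: within_continuous_mx => i k.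
pose LL : {linear 'M[C]_(m, n) -> 'M[C]_(m', n')} :=
  HB.pack L (GRing.isLinear.Build _ _ _ _ L L_lin).
have LE t : (v *m L (f t)) i k =
    \sum_(a < m) \sum_(b < n) f t a b * (v *m L (delta_mx a b)) i k.
  rewrite -[L]/(LL : _ -> _) {1}(matrix_sum_delta (f t)) linear_sum mulmx_sumr.
  rewrite summxE; apply: eq_bigr => a _; rewrite linear_sum mulmx_sumr summxE.
  by apply: eq_bigr => b _; rewrite linearZ -scalemxAr mxE.
rewrite (funext LE : (fun t => (v *m L (f t)) i k : C^o) = _).
have fab a b : {within B, continuous (fun t => f t a b : C^o)}.
  have fE t : f t a b = (delta_mx 0 a *m f t : 'rV[C^o]_n) 0 b.
    by rewrite -rowE mxE.
  rewrite (funext fE : (fun t => f t a b : C^o) = _) => t.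
  exact: (continuous_comp (fc (delta_mx 0 a) t) (@coord_continuous C 1 n 0 b _)).
move=> t; apply: cvg_big => [|a _]; first exact: add_continuous.
apply: cvg_big => [|b _]; first exact: add_continuous.
by apply: cvgMr_tmp; exact: fab.
Qed.

End Continuity.

(** * Functors of modules and Karoubi groups *)

Section ConstantPath.
Context (R : realType) (G : magneticGroup) (p q : nat).

Lemma constant_path_continuous (E F : gmod R G p q) (s : {linear E -> F}) :
  continuous_path (fun _ => s).
Proof. by move=> v; apply: continuous_subspaceT => t; exact: cvg_cst. Qed.

(** With a constant path, the identification of triples reduces to a pair of
    isomorphisms of degree zero which carries one map to the other. *)
Lemma tr_equiv_iso (T T' : triple R G p q)
    (X : 'M_(gm_dim (tr_src T), gm_dim (tr_src T')))
    (Y : 'M_(gm_dim (tr_tgt T), gm_dim (tr_tgt T'))) :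
    is_hom X -> is_deg0 X -> mx_iso X -> is_hom Y -> is_deg0 Y -> mx_iso Y ->
    mx_of (tr_map T) *m Y = X *m mx_of (tr_map T') ->
  tr_equiv T T'.
Proof.
move=> hX X0 Xb hY Y0 Yb XY.
exists (lin_of hX), (lin_of hY), (fun=> tr_map T); split.
- by split; [exact: lin_of_bij|exact: X0].
- by split; [exact: lin_of_bij|exact: Y0].
- by split=> [|t _]; [exact: constant_path_continuous|exact: tr_bij].
- by [].
- move=> v /=; rewrite /mx_fun -(mul_mx_of (tr_map T)) -mulmxA XY mulmxA.
  by rewrite mul_mx_of.
Qed.

End ConstantPath.

(** A functor of modules which acts on maps by a complex linear function of
    their matrices.  Linearity gives both the continuity needed for paths and
    the compatibility with direct sums. *)
Record mxfunctor (R : realType) (G : magneticGroup) (p q p' q' : nat) :=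
MxFunctor {
  fobj :> gmod R G p q -> gmod R G p' q';
  fmx : forall E F : gmod R G p q, 'M[R[i]]_(gm_dim E, gm_dim F) ->
    'M[R[i]]_(gm_dim (fobj E), gm_dim (fobj F));
  fmx_linear : forall E F, linear (@fmx E F);
  fmx_hom : forall E F (S : 'M_(gm_dim E, gm_dim F)),
    is_hom S -> is_hom (fmx S);
  fmx_deg0 : forall E F (S : 'M_(gm_dim E, gm_dim F)),
    is_hom S -> is_deg0 S -> is_deg0 (fmx S);
  fmx1 : forall E, fmx (1%:M : 'M_(gm_dim E)) = 1%:M;
  fmxM : forall E F H (S : 'M_(gm_dim E, gm_dim F)) (S' : 'M_(gm_dim F, gm_dim H)),
    is_hom S -> is_hom S' -> fmx (S *m S') = fmx S *m fmx S' }.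

Arguments fmx_hom {R G p q p' q'} m {E F S}.
Arguments fmx_deg0 {R G p q p' q'} m {E F S}.

Section InducedMap.
Context (R : realType) (G : magneticGroup) (p q p' q' : nat).
Variable Phi : mxfunctor R G p q p' q'.

Lemma fmxD E F : {morph @fmx _ _ _ _ _ _ Phi E F : S S' / S + S'}.
Proof. by move=> S S'; rewrite -[S]scale1r fmx_linear !scale1r. Qed.

Lemma fmx0 E F : @fmx _ _ _ _ _ _ Phi E F 0 = 0.
Proof. by apply: (addrI (fmx Phi 0)); rewrite -fmxD !addr0. Qed.

Lemma fmx_iso E F (S : 'M_(gm_dim E, gm_dim F)) :
  is_hom S -> mx_iso S -> mx_iso (fmx Phi S).
Proof.
move=> hS [S' [SS' S'S]]; have hS' := is_hom_inv hS SS' S'S.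
by exists (fmx Phi S'); split; rewrite -fmxM // ?SS' ?S'S fmx1.
Qed.

Definition flin (E F : gmod R G p q) (s : {linear E -> F}) :
    {linear Phi E -> Phi F} :=
  lin_of (fmx_hom Phi (mx_of_hom s)).

Lemma flinE (E F : gmod R G p q) (s : {linear E -> F}) v :
  flin s v = v *m fmx Phi (mx_of s).
Proof. by []. Qed.

Lemma flin_bij (E F : gmod R G p q) (s : {linear E -> F}) :
  bijective s -> bijective (flin s).
Proof.
move=> sb; apply: lin_of_bij; apply: fmx_iso; first exact: mx_of_hom.
exact: mx_of_iso.
Qed.

Lemma flin_degree0 (E F : gmod R G p q) (s : {linear E -> F}) :
  degree0 s -> degree0 (flin s).
Proof. move=> s0; exact: (fmx_deg0 Phi (mx_of_hom s) (mx_of_deg0 s0)). Qed.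

Definition ftriple (T : triple R G p q) : triple R G p' q' :=
  Triple (flin_bij (tr_bij T)).

Lemma ftriple_equiv T T' : tr_equiv T T' -> tr_equiv (ftriple T) (ftriple T').
Proof.
move=> [f [g [s [[fb f0] [gb g0] [sc sb] s0 s1]]]].
exists (flin f), (flin g), (fun t => flin (s t)); split.
- by split; [exact: flin_bij|exact: flin_degree0].
- by split; [exact: flin_bij|exact: flin_degree0].
- split=> [v|t ht]; last exact/flin_bij/sb.
  apply: (within_continuous_linear (@fmx_linear _ _ _ _ _ _ Phi _ _)) => w.
  rewrite (_ : (fun t => _) = fun t => s t w : 'rV[R[i]^o]_ _); first exact: sc.
  by apply: funext => t; exact: mul_mx_of.
- move=> v; rewrite [LHS]flinE [RHS]flinE; congr (_ *m fmx Phi _).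
  by apply: eq_mulmx_rV => w; rewrite !mul_mx_of; exact: s0.
- move=> v; rewrite /= ![LHS]flinE ![RHS]flinE -!mulmxA.
  rewrite -!fmxM; try exact: mx_of_hom.
  congr (_ *m fmx Phi _).
  by apply: eq_mulmx_rV => w; rewrite !mulmxA !mul_mx_of; exact: s1.
Qed.

Section Additivity.
Variables E E' : gmod R G p q.

(** A linear functor preserves the biproduct [dsum E E']; this is the comparison
    map given by the images of the two projections. *)
Definition fsplit : 'M[R[i]]_(gm_dim (Phi (dsum E E')),
    gm_dim (dsum (Phi E) (Phi E'))) :=
  row_mx (fmx Phi (dsum_pr1 E E')) (fmx Phi (dsum_pr2 E E')).

Lemma fsplit_hom : is_hom fsplit.
Proof.
by apply: is_hom_row; apply: fmx_hom; [exact: dsum_pr1_hom|exact: dsum_pr2_hom].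
Qed.

Lemma fsplit_deg0 : is_deg0 fsplit.
Proof.
apply: is_deg0_row; apply: fmx_deg0.
- exact: dsum_pr1_hom.
- exact: dsum_pr1_deg0.
- exact: dsum_pr2_hom.
- exact: dsum_pr2_deg0.
Qed.

Lemma fsplit_iso : mx_iso fsplit.
Proof.
have h1 := @dsum_in1_hom _ _ _ _ E E'; have h2 := @dsum_in2_hom _ _ _ _ E E'.
have k1 := @dsum_pr1_hom _ _ _ _ E E'; have k2 := @dsum_pr2_hom _ _ _ _ E E'.
exists (col_mx (fmx Phi (dsum_in1 E E')) (fmx Phi (dsum_in2 E E'))); split.
- by rewrite mul_row_col -!fmxM // -fmxD dsum_pr_in fmx1.
- rewrite mul_col_row -!fmxM // dsum_in1_pr1 dsum_in1_pr2 dsum_in2_pr1.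
  by rewrite dsum_in2_pr2 !fmx1 !fmx0 -scalar_mx_block.
Qed.

End Additivity.

Lemma fsplit_natural (E E' F F' : gmod R G p q)
    (s : {linear E -> F}) (s' : {linear E' -> F'}) :
  fmx Phi (mx_of (dsum_map s s')) *m fsplit F F' =
  fsplit E E' *m block_mx (fmx Phi (mx_of s)) 0 0 (fmx Phi (mx_of s')).
Proof.
have hs := mx_of_hom s; have hs' := mx_of_hom s'.
have hd := mx_of_hom (dsum_map s s').
have h1 := @dsum_pr1_hom _ _ _ _ E E'; have h2 := @dsum_pr2_hom _ _ _ _ E E'.
have k1 := @dsum_pr1_hom _ _ _ _ F F'; have k2 := @dsum_pr2_hom _ _ _ _ F F'.
rewrite mul_mx_row mul_row_block !mulmx0 addr0 add0r -!fmxM //.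
congr (row_mx (fmx Phi _) (fmx Phi _)); rewrite mx_of_dsum_map.
  by rewrite mul_dsum_pr1 mul_col_mx mul1mx mul0mx block_mxEh row_mxKl.
by rewrite mul_dsum_pr2 mul_col_mx mul1mx mul0mx block_mxEh row_mxKr.
Qed.

Lemma ftriple_sum T T' :
  tr_equiv (ftriple (tr_sum T T')) (tr_sum (ftriple T) (ftriple T')).
Proof.
apply: (@tr_equiv_iso _ _ _ _ (ftriple (tr_sum T T')) (tr_sum (ftriple T) (ftriple T'))
  (fsplit (tr_src T) (tr_src T')) (fsplit (tr_tgt T) (tr_tgt T')));
  try by [exact: fsplit_hom|exact: fsplit_deg0|exact: fsplit_iso].
rewrite mx_of_dsum_map !lin_ofK.
exact: fsplit_natural.
Qed.

Fixpoint fterm (x : kg_term R G p q) : kg_term R G p' q' :=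
  match x with
  | KgZero => @KgZero R G p' q'
  | KgGen T => KgGen (ftriple T)
  | KgAdd x y => KgAdd (fterm x) (fterm y)
  | KgOpp x => KgOpp (fterm x)
  end.

Lemma fterm_eq x y : kg_eq x y -> kg_eq (fterm x) (fterm y).
Proof.
elim=> {x y}.
- by move=> x; exact: kg_refl.
- by move=> x y _; exact: kg_sym.
- by move=> y x z _ xy _; exact: kg_trans xy.
- by move=> x x' y y' _ ? _ ?; exact: kg_congrD.
- by move=> x x' _ ?; exact: kg_congrN.
- by move=> x y z; exact: kg_addA.
- by move=> x y; exact: kg_addC.
- by move=> x; exact: kg_add0.
- by move=> x; exact: kg_addN.
- by move=> T T' /ftriple_equiv; exact: kg_rel_equiv.
- move=> T T'; apply: kg_trans (kg_rel_sum _ _).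
  exact/kg_rel_equiv/ftriple_sum.
- by move=> T T0; apply: kg_rel_degree0; exact: flin_degree0.
Qed.

Definition KG_map (x : KG R G p q) : KG R G p' q' :=
  kg_class (fterm (generic_quotient.repr x)).

Lemma KG_map_class x : KG_map (kg_class x) = kg_class (fterm x).
Proof. by apply/kg_classP; apply: fterm_eq; exact: kg_repr. Qed.

Lemma KG_mapD : {morph KG_map : x y / x + y}.
Proof.
elim/kg_ind=> x; elim/kg_ind=> y.
by rewrite [_ + _]kg_class_add !KG_map_class [RHS]kg_class_add.
Qed.

Fact KG_map_zmod_morphism : zmod_morphism KG_map.
Proof.
by move=> x y; apply: (addIr (KG_map y)); rewrite -KG_mapD !subrK.
Qed.

HB.instance Definition _ :=
  GRing.isZmodMorphism.Build _ _ KG_map KG_map_zmod_morphism.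

End InducedMap.

Record natural_iso (R : realType) (G : magneticGroup) (p q p' q' : nat)
    (Phi : mxfunctor R G p q p' q') (Psi : mxfunctor R G p' q' p q)
    (theta : forall E, 'M_(gm_dim E, gm_dim (Psi (Phi E)))) : Prop := {
  nat_hom : forall E, is_hom (theta E);
  nat_deg0 : forall E, is_deg0 (theta E);
  nat_iso : forall E, mx_iso (theta E);
  nat_comm : forall E F (S : 'M_(gm_dim E, gm_dim F)), is_hom S ->
    S *m theta F = theta E *m fmx Psi (fmx Phi S) }.

(** A natural isomorphism of degree zero, with the constant path, identifies a
    triple with its image under the composed functors. *)
Lemma KG_mapK (R : realType) (G : magneticGroup) (p q p' q' : nat)
    (Phi : mxfunctor R G p q p' q') (Psi : mxfunctor R G p' q' p q) theta :
  @natural_iso R G p q p' q' Phi Psi theta -> cancel (KG_map Phi) (KG_map Psi).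
Proof.
move=> nat; elim/kg_ind=> x; rewrite !KG_map_class; apply/kg_classP.
elim: x => [|T|x IHx y IHy|x IHx] /=.
- exact: kg_refl.
- apply/kg_sym/kg_rel_equiv.
  apply: (@tr_equiv_iso _ _ _ _ T (ftriple Psi (ftriple Phi T))
    (theta (tr_src T)) (theta (tr_tgt T)));
    try by [exact: nat_hom|exact: nat_deg0|exact: nat_iso].
  by rewrite (nat_comm nat (mx_of_hom (tr_map T))) !lin_ofK.
- exact: kg_congrD.
- exact: kg_congrN.
Qed.

(** * Systems of operators and graded modules *)

Lemma scale_half (K : numFieldType) (V : lmodType K) (u : V) :
  2^-1 *: (u + u) = u.
Proof.
by rewrite -[u in u + u]scale1r -scalerDl scalerA mulVf ?scale1r ?pnatr_eq0.
Qed.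

Lemma Kpow0 (R : realType) (z : R[i]) : Kpow 0 z = z.
Proof. by []. Qed.

Section Conjugation.
Context (R : realType).

Fact Kpow_zmod_morphism (a : 'Z_2) : zmod_morphism (@Kpow R a).
Proof. by move=> x y; rewrite /Kpow; case: ifP => // _; rewrite rmorphB. Qed.

Fact Kpow_monoid_morphism (a : 'Z_2) : monoid_morphism (@Kpow R a).
Proof.
by split=> [|x y]; rewrite /Kpow; case: ifP => // _; rewrite ?rmorph1 ?rmorphM.
Qed.

HB.instance Definition _ (a : 'Z_2) :=
  GRing.isZmodMorphism.Build _ _ (@Kpow R a) (Kpow_zmod_morphism a).
HB.instance Definition _ (a : 'Z_2) :=
  GRing.isMonoidMorphism.Build _ _ (@Kpow R a) (Kpow_monoid_morphism a).

Definition Zsign (a : 'Z_2) : R[i] := if a == 0 then 1 else -1.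

Lemma Z2_cases (a : 'Z_2) : a = 0 \/ a = 1.
Proof.
by case: a => [[|[|a]] // ?]; [left|right]; apply: val_inj.
Qed.

Lemma ZsignD a b : Zsign (a + b) = Zsign a * Zsign b.
Proof.
by case: (Z2_cases a) (Z2_cases b) => -> [] ->; rewrite /Zsign /= ?mulr1 ?mul1r
  ?mulrNN ?mulr1.
Qed.

Lemma KpowD a b (z : R[i]) : Kpow (a + b) z = Kpow a (Kpow b z).
Proof.
by case: (Z2_cases a) (Z2_cases b) => -> [] ->; rewrite /Kpow //= conjcK.
Qed.

Lemma Kpow_real a (r : R) : Kpow a r%:C = r%:C.
Proof. by rewrite /Kpow; case: ifP => // _; rewrite conjc_real. Qed.

Lemma Kpow_i a : @Kpow R a 'i = Zsign a * 'i.
Proof.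
rewrite /Kpow /Zsign; case: ifP => _; rewrite ?mul1r // mulN1r.
by apply/eqP; rewrite eq_complex /= oppr0 !eqxx.
Qed.

Lemma Kpow_sign a b : Kpow a (Zsign b) = Zsign b.
Proof. by rewrite /Zsign; case: ifP; rewrite ?rmorphN1 ?rmorph1. Qed.

End Conjugation.

Local Notation Kmx a := (map_mx (Kpow a)).

Lemma KmxD (R : realType) (m n : nat) a b (X : 'M[R[i]]_(m, n)) :
  Kmx (a + b) X = Kmx a (Kmx b X).
Proof. by apply/matrixP => i j; rewrite !mxE KpowD. Qed.

Lemma Kmx0 (R : realType) (m n : nat) (X : 'M[R[i]]_(m, n)) : Kmx 0 X = X.
Proof. by apply/matrixP => i j; rewrite !mxE. Qed.

Lemma KmxK (R : realType) (m n : nat) a (X : 'M[R[i]]_(m, n)) :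
  Kmx a (Kmx a X) = X.
Proof. by rewrite -KmxD; case: (Z2_cases a) => ->; exact: Kmx0. Qed.

(** [o_act g] is the matrix [T] for which [g] sends the row vector [v] to
    [Kmx (mg_phi g) v *m T]; [o_par] is 1 on even vectors and -1 on odd ones. *)
Record ops (R : realType) (G : magneticGroup) (m n : nat) := Ops {
  o_gen : 'I_m -> 'M[R[i]]_n;
  o_act : G -> 'M[R[i]]_n;
  o_par : 'M[R[i]]_n }.

Record is_rep (R : realType) (G : magneticGroup) (p q n : nat)
    (O : ops R G (p + q) n) : Prop := {
  rep_sq : forall j : 'I_(p + q),
    o_gen O j *m o_gen O j = (if (j < p)%N then 1 else -1)%:M;
  rep_anti : forall j k, j != k ->
    o_gen O j *m o_gen O k = - (o_gen O k *m o_gen O j);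
  rep_par2 : o_par O *m o_par O = 1%:M;
  rep_gen_par : forall j, o_gen O j *m o_par O = - (o_par O *m o_gen O j);
  rep_act1 : o_act O 1%g = 1%:M;
  rep_actM : forall g h,
    o_act O (g * h)%g = Kmx (mg_phi g) (o_act O h) *m o_act O g;
  rep_act_gen : forall g j,
    Kmx (mg_phi g) (o_gen O j) *m o_act O g = o_act O g *m o_gen O j;
  rep_act_par : forall g,
    Kmx (mg_phi g) (o_par O) *m o_act O g = o_act O g *m o_par O }.

Section ModuleOfOperators.
Context (R : realType) (G : magneticGroup) (p q n : nat).
Variables (O : ops R G (p + q) n) (repO : is_rep O).
Local Notation A := (magalg R G p q).

Let sc0 : ((0 : R)%:C)%:M = 0 :> 'M[R[i]]_n. Proof. by rewrite rmorph0. Qed.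
Let sc1 : ((1 : R)%:C)%:M = 1%:M :> 'M[R[i]]_n. Proof. by []. Qed.
Let scN1 : ((-1 : R)%:C)%:M = - 1%:M :> 'M[R[i]]_n.
Proof. by rewrite [(-1)%:C]rmorphN1 raddfN. Qed.

(** The factors of a product are exchanged because matrices act on the right. *)
Fixpoint tev (x : cl_term R p q) : 'M[R[i]]_n :=
  match x with
  | ClScal a => (a%:C)%:M
  | ClGen j => o_gen O j
  | ClAdd x y => tev x + tev y
  | ClMul x y => tev y *m tev x
  end.

Lemma tev_eq x y : cl_eq x y -> tev x = tev y.
Proof.
elim=> {x y} //=.
- by move=> y x z _ -> _ ->.
- by move=> x x' y y' _ -> _ ->.
- by move=> x x' y y' _ -> _ ->.
- by move=> x y z; rewrite addrA.
- by move=> x y; rewrite addrC.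
- by move=> x; rewrite sc0 add0r.
- by move=> x; rewrite scN1 sc0 mulmxN mulmx1 addNr.
- by move=> x y z; rewrite mulmxA.
- by move=> x; rewrite sc1 mulmx1.
- by move=> x y z; rewrite mulmxDr.
- by move=> x y z; rewrite mulmxDl.
- by move=> a b; rewrite rmorphD raddfD.
- by move=> a b; rewrite rmorphM mulrC scalar_mxM.
- by move=> a x; rewrite scalar_mxC.
- move=> i j ij; rewrite scN1 mulmxN mulmx1.
  by rewrite (rep_anti repO) // eq_sym.
- by move=> j; rewrite (rep_sq repO); case: ifP => _; rewrite ?scN1 ?sc1 ?raddfN.
Qed.

(** The Clifford algebra is a quotient of terms; [tev_eq] makes the value of a
    representative independent of the choice. *)
Definition cev (x : clifford R p q) : 'M[R[i]]_n :=
  tev (generic_quotient.repr x).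

Lemma cev_class x : cev (cl_class x) = tev x.
Proof. by apply: tev_eq; exact: cl_repr. Qed.

Lemma cevD x y : cev (x + y) = cev x + cev y.
Proof.
elim/cl_ind: x => x; elim/cl_ind: y => y.
by rewrite cl_addE !cev_class.
Qed.

Lemma cevM x y : cev (x * y) = cev y *m cev x.
Proof.
elim/cl_ind: x => x; elim/cl_ind: y => y.
by rewrite cl_mulE !cev_class.
Qed.

Lemma cev_scal a : cev (cl_scal p q a) = (a%:C)%:M.
Proof. exact: cev_class. Qed.

Lemma cev_gen j : cev (cl_gen R j) = o_gen O j.
Proof. exact: cev_class. Qed.

Lemma cev0 : cev 0 = 0.
Proof. by rewrite -cl_scal0 cev_scal sc0. Qed.

Lemma cevN x : cev (- x) = - cev x.
Proof. by apply: (addIr (cev x)); rewrite -cevD !addNr cev0. Qed.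

Lemma cev_act g x :
  Kmx (mg_phi g) (cev x) *m o_act O g = o_act O g *m cev x.
Proof.
elim/cl_ind: x => x; rewrite cev_class; elim: x => /=.
- by move=> a; rewrite map_scalar_mx /= Kpow_real scalar_mxC.
- exact: rep_act_gen.
- by move=> x IHx y IHy; rewrite map_mxD mulmxDl mulmxDr IHx IHy.
- by move=> x IHx y IHy; rewrite map_mxM -mulmxA IHx mulmxA IHy mulmxA.
Qed.

Lemma cev_homog i x : cl_homog i x ->
  cev x *m o_par O = Zsign R i *: (o_par O *m cev x).
Proof.
elim=> {i x}.
- by move=> i; rewrite cev0 mul0mx mulmx0 scaler0.
- by move=> a; rewrite cev_scal scalar_mxC scale1r.
- by move=> j; rewrite cev_gen (rep_gen_par repO) scaleN1r.
- by move=> i x y _ IHx _ IHy; rewrite cevD mulmxDl IHx IHy mulmxDr scalerDr.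
- move=> i j x y _ IHx _ IHy; rewrite cevM -mulmxA IHx -scalemxAr.
  rewrite [cev y *m (_ *m _)]mulmxA IHy.
  by rewrite -scalemxAl scalerA ZsignD -mulmxA.
Qed.

Definition ccev (x : ccliff R p q) : 'M[R[i]]_n := cev x.1 + 'i *: cev x.2.

Lemma ccevD x y : ccev (x + y) = ccev x + ccev y.
Proof. by rewrite /ccev !cevD scalerDr addrACA. Qed.

Lemma ccev0 : ccev 0 = 0.
Proof. by rewrite /ccev !cev0 scaler0 addr0. Qed.

Lemma ccevM x y : ccev (x * y) = ccev y *m ccev x.
Proof.
rewrite /ccev /= !cevD cevN !cevM mulmxDl !mulmxDr -!scalemxAl -!scalemxAr.
rewrite scalerA -expr2 sqr_i scaleN1r scalerDr.
by rewrite [X in _ = _ + X]addrC [RHS]addrACA [X in _ = _ + X]addrC.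
Qed.

Lemma ccev_scal z : ccev (ccl_scal p q z) = z%:M.
Proof.
rewrite /ccev !cev_scal scale_scalar_mx -raddfD; congr _%:M.
by rewrite -complexE.
Qed.

Lemma ccev_act g x : Kmx (mg_phi g) (ccev x) *m o_act O g =
  o_act O g *m ccev (ccl_Kpow (mg_phi g) x).
Proof.
rewrite /ccev map_mxD map_mxZ mulmxDl -scalemxAl !cev_act.
rewrite [X in X *: _](Kpow_i R (mg_phi g)).
rewrite mulmxDr -scalemxAr /ccl_Kpow /Zsign; case: ifP => _.
  by rewrite mul1r.
by rewrite mulN1r scaleNr cevN mulmxN scalerN.
Qed.

Lemma ccev_sum (I : Type) (r : seq I) (F : I -> ccliff R p q) :
  ccev (\sum_(i <- r) F i) = \sum_(i <- r) ccev (F i).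
Proof. exact: (big_morph ccev ccevD ccev0). Qed.

Definition o_mact (a : A) (v : 'rV[R[i]]_n) : 'rV[R[i]]_n :=
  \sum_g Kmx (mg_phi g) v *m o_act O g *m ccev (a g).

Lemma o_mact_symb x g v :
  o_mact (symb x g) v = Kmx (mg_phi g) v *m o_act O g *m ccev x.
Proof.
rewrite /o_mact (bigD1 g) //= big1 ?addr0 => [|h /negPf hg].
  by rewrite ffunE eqxx.
by rewrite ffunE hg ccev0 mulmx0.
Qed.

Fact o_mactA a b v : o_mact a (o_mact b v) = o_mact (a * b) v.
Proof.
rewrite /o_mact.
under [RHS]eq_bigr => k _.
  rewrite ffunE ccev_sum mulmx_sumr; over.
rewrite [RHS]exchange_big /=; apply: eq_bigr => g _.
rewrite map_mx_sum !mulmx_suml [RHS](reindex_inj (mulgI g)) /=.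
apply: eq_bigr => h _.
rewrite mulKg ccevM mg_phiM KmxD (rep_actM repO) !map_mxM !mulmxA.
by congr (_ *m _); rewrite -!mulmxA; congr (_ *m _); congr (_ *m _); exact: ccev_act.
Qed.

Fact o_mact1 : left_id 1 o_mact.
Proof.
move=> v; rewrite [1]/(symb 1 1%g) o_mact_symb mg_phi1 Kmx0 (rep_act1 repO).
by rewrite mulmx1 [ccev _](ccev_scal 1) mulmx1.
Qed.

Fact o_mactDr : right_distributive o_mact +%R.
Proof.
move=> a v w; rewrite /o_mact -big_split; apply: eq_bigr => g _.
by rewrite map_mxD !mulmxDl.
Qed.

Fact o_mactDl v : {morph o_mact^~ v : a b / a + b}.
Proof.
move=> a b; rewrite /o_mact -big_split; apply: eq_bigr => g _.
by rewrite ffunE ccevD mulmxDr.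
Qed.

Fact o_mact_scal z v : o_mact (magalg_scal G p q z) v = z *: v.
Proof.
rewrite o_mact_symb mg_phi1 Kmx0 (rep_act1 repO) mulmx1 ccev_scal.
exact: mul_mx_scalar.
Qed.

Definition o_hom (i : 'Z_2) : set 'rV[R[i]]_n :=
  [set v | v *m o_par O = Zsign R i *: v].

Fact o_hom0 i : o_hom i 0.
Proof. by rewrite /o_hom /= mul0mx scaler0. Qed.

Fact o_homB i v w : o_hom i v -> o_hom i w -> o_hom i (v - w).
Proof. by rewrite /o_hom /= => hv hw; rewrite mulmxBl hv hw scalerBr. Qed.

Fact o_hom_dec v : exists! w : 'rV[R[i]]_n * 'rV[R[i]]_n,
  [/\ o_hom 0 w.1, o_hom 1 w.2 & v = w.1 + w.2].
Proof.
have par2 := rep_par2 repO.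
exists (2^-1 *: (v + v *m o_par O), 2^-1 *: (v - v *m o_par O)); split=> /=.
  rewrite /o_hom /Zsign /= scale1r scaleN1r -!scalemxAl mulmxDl mulmxBl.
  rewrite -mulmxA par2 mulmx1; split.
  - by rewrite addrC.
  - by rewrite -scalerN opprB.
  - by rewrite -scalerDr addrACA subrr addr0 scale_half.
move=> [x y] /= []; rewrite /o_hom /Zsign /= scale1r scaleN1r => hx hy ->.
rewrite mulmxDl hx hy; congr (_, _).
  by rewrite addrACA subrr addr0 scale_half.
by rewrite opprB [x + y + _]addrC addrA subrK scale_half.
Qed.

Fact o_hom_act i j a v :
  magalg_homog i a -> o_hom j v -> o_hom (i + j) (o_mact a v).
Proof.
rewrite /o_hom /= => ai vj; rewrite /o_mact mulmx_suml scaler_sumr.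
apply: eq_bigr => g _; have [a1 a2] := ai g.
have ccp : ccev (a g) *m o_par O = Zsign R i *: (o_par O *m ccev (a g)).
  rewrite /ccev mulmxDl -scalemxAl !(cev_homog a1, cev_homog a2) mulmxDr.
  by rewrite -scalemxAr scalerDr !scalerA mulrC.
rewrite -mulmxA ccp -scalemxAr mulmxA -[_ *m _ *m o_par O]mulmxA.
rewrite -(rep_act_par repO) mulmxA -map_mxM vj map_mxZ /= Kpow_sign.
by rewrite -!scalemxAl scalerA ZsignD.
Qed.

Definition gmod_of : gmod R G p q := Gmod o_mactA o_mact1 o_mactDr o_mactDl
  o_mact_scal o_hom0 o_homB o_hom_dec o_hom_act.

End ModuleOfOperators.

Section OperatorsOfModule.
Context (R : realType) (G : magneticGroup) (p q : nat).
Variable E : gmod R G p q.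
Local Notation n := (gm_dim E).

Lemma ccl_scalC z (x : ccliff R p q) : x * ccl_scal p q z = ccl_scal p q z * x.
Proof.
case: x => x y; congr pair => /=; rewrite !cl_quot_scalC //.
by rewrite addrC.
Qed.

Lemma ccl_Kpow_scal a (z : R[i]) :
  ccl_Kpow a (ccl_scal p q z) = ccl_scal p q (Kpow a z).
Proof.
rewrite /ccl_Kpow /Kpow; case: ifP => // _; case: z => x y.
rewrite /ccl_scal /=; congr pair.
by rewrite -[- cl_scal _ _ _]cl_scalN1 -cl_quot_scalM mulN1r.
Qed.

(** The scalar [z] is the symbol of [ccl_scal z] at [1], central in the
    complexified Clifford algebra and conjugated when it passes [g]. *)
Lemma gm_act_semilinear x g z (v : 'rV_n) :
  gm_act (symb x g) (z *: v) = Kpow (mg_phi g) z *: gm_act (symb x g) v.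
Proof.
rewrite -!gm_act_scal !gm_actA !symbM ccl_Kpow_scal ccl_scalC.
by rewrite mulg1 mul1g mg_phi1.
Qed.

(** The conjugation inside makes the function complex linear also for
    antilinear [g]. *)
Definition opmx x g : 'M[R[i]]_n :=
  lin1_mx (fun v : 'rV_n => gm_act (symb x g) (Kmx (mg_phi g) v)).

Lemma mul_opmx x g (v : 'rV_n) :
  v *m opmx x g = gm_act (symb x g) (Kmx (mg_phi g) v).
Proof.
pose f (v : 'rV[R[i]]_n) : 'rV[R[i]]_n :=
  gm_act (symb x g) (Kmx (mg_phi g) v).
have f_lin : linear f.
  move=> z u w; rewrite /f map_mxD map_mxZ gm_actDr gm_act_semilinear /=.
  by congr (_ *: _ + _); rewrite -KpowD; case: (Z2_cases (mg_phi g)) => ->.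
pose ff : {linear 'rV[R[i]]_n -> 'rV[R[i]]_n} :=
  HB.pack f (GRing.isLinear.Build _ _ _ _ f f_lin).
exact: (mul_rV_lin1 ff).
Qed.

Lemma gm_act_symb x g (v : 'rV_n) :
  gm_act (symb x g) v = Kmx (mg_phi g) v *m opmx x g.
Proof. by rewrite mul_opmx KmxK. Qed.

Lemma opmxM x y g h :
  opmx (x * ccl_Kpow (mg_phi g) y) (g * h)%g =
  Kmx (mg_phi g) (opmx y h) *m opmx x g.
Proof.
apply: eq_mulmx_rV => v.
have KK : Kmx (mg_phi g) (Kmx (mg_phi h) (Kmx (mg_phi (g * h)%g) v)) = v.
  by rewrite mg_phiM -KmxD KmxK.
by rewrite mul_opmx -symbM -gm_actA !gm_act_symb map_mxM KK mulmxA.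
Qed.

Lemma opmx1M x y g : opmx (x * y) g = opmx y g *m opmx x 1%g.
Proof.
by have := opmxM x y 1%g g; rewrite mg_phi1 Kmx0 mul1g.
Qed.

Lemma opmx_scal z : opmx (ccl_scal p q z) 1%g = z%:M.
Proof.
apply: eq_mulmx_rV => v.
by rewrite mul_opmx mg_phi1 Kmx0 mul_mx_scalar; exact: gm_act_scal.
Qed.

Lemma opmx1 : opmx 1 1%g = 1%:M.
Proof. exact: (opmx_scal 1). Qed.

Lemma opmxD x y g : opmx (x + y) g = opmx x g + opmx y g.
Proof.
apply: eq_mulmx_rV => v.
by rewrite mulmxDr !mul_opmx symbD gm_actDl.
Qed.

Lemma opmxN x g : opmx (- x) g = - opmx x g.
Proof.
have opmx0 : opmx 0 g = 0.
  by apply: (addrI (opmx 0 g)); rewrite -opmxD !addr0.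
by apply: (addIr (opmx x g)); rewrite -opmxD !addNr.
Qed.

Definition re_ccl (x : clifford R p q) : ccliff R p q := (x, 0).

Lemma re_cclM x y : re_ccl (x * y) = re_ccl x * re_ccl y.
Proof. by congr pair => /=; rewrite !(mulr0, mul0r, subr0, addr0). Qed.

Lemma re_cclN x : re_ccl (- x) = - re_ccl x.
Proof. by congr pair; rewrite oppr0. Qed.

Lemma ccl_Kpow_re a x : ccl_Kpow a (re_ccl x) = re_ccl x.
Proof. by rewrite /ccl_Kpow; case: ifP => //= _; rewrite oppr0. Qed.

Definition evenodd (v : 'rV[R[i]]_n) : 'rV[R[i]]_n * 'rV[R[i]]_n :=
  sval (cid (gm_hom_dec v)).

Lemma evenoddP v :
  [/\ gm_hom 0 (evenodd v).1, gm_hom 1 (evenodd v).2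
    & v = (evenodd v).1 + (evenodd v).2].
Proof. by rewrite /evenodd; case: cid => w []. Qed.

Lemma evenodd_unique v a b :
  gm_hom 0 a -> gm_hom 1 b -> v = a + b -> evenodd v = (a, b).
Proof. by move=> ha hb ->; rewrite /evenodd; case: cid => w [h u]; exact: u. Qed.

Lemma gm_homD i (v w : 'rV_n) : gm_hom i v -> gm_hom i w -> gm_hom i (v + w).
Proof.
move=> hv hw; rewrite -[w]opprK; apply: gm_homB => //.
by rewrite -sub0r; apply: gm_homB => //; exact: gm_hom0.
Qed.

Lemma gm_homZ i z (v : 'rV_n) : gm_hom i v -> gm_hom i (z *: v).
Proof.
move=> hv; rewrite -gm_act_scal -(add0r i); apply: gm_hom_act hv => g.
rewrite ffunE; case: ifP => _; split;
  by [exact: cl_homog_scal|exact: cl_homog0].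
Qed.

Definition parity (v : 'rV[R[i]]_n) := (evenodd v).1 - (evenodd v).2.

Definition parmx : 'M[R[i]]_n := lin1_mx parity.

Lemma mul_parmx v : v *m parmx = parity v.
Proof.
have f_lin : linear parity.
  move=> z u w; have [u0 u1 uE] := evenoddP u; have [w0 w1 wE] := evenoddP w.
  rewrite {1}/parity (@evenodd_unique (z *: u + w) (z *: (evenodd u).1 + (evenodd w).1)
     (z *: (evenodd u).2 + (evenodd w).2)) /=.
  - by rewrite /parity scalerBr opprD addrACA.
  - by apply: gm_homD => //; exact: gm_homZ.
  - by apply: gm_homD => //; exact: gm_homZ.
  - by rewrite addrACA -scalerDr -uE -wE.
pose ff : {linear 'rV[R[i]]_n -> 'rV[R[i]]_n} :=
  HB.pack parity (GRing.isLinear.Build _ _ _ _ parity f_lin).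
exact: (mul_rV_lin1 ff).
Qed.

Lemma gm_hom_parmx i (v : 'rV_n) : gm_hom i v -> v *m parmx = Zsign R i *: v.
Proof.
rewrite mul_parmx /parity; case: (Z2_cases i) => -> hv.
  rewrite (@evenodd_unique v v 0) ?addr0 //; last exact: gm_hom0.
  by rewrite subr0 /Zsign eqxx scale1r.
rewrite (@evenodd_unique v 0 v) ?add0r //; last exact: gm_hom0.
by rewrite /Zsign /= scaleN1r.
Qed.

Lemma parmx_gm_hom i (v : 'rV_n) : v *m parmx = Zsign R i *: v -> gm_hom i v.
Proof.
have half (u : 'rV[R[i]]_n) : u + u = 0 -> u = 0.
  by move=> u0; rewrite -[u]scale_half u0 scaler0.
have [v0 v1 vE] := evenoddP v.
rewrite mul_parmx /parity [in X in _ = X]vE; case: (Z2_cases i) => ->.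
  rewrite /Zsign eqxx scale1r => /addrI /eqP; rewrite eq_sym -addr_eq0.
  by move=> /eqP /half v10; rewrite vE v10 addr0.
rewrite /Zsign /= scaleN1r opprD => /addIr /eqP; rewrite -addr_eq0.
by move=> /eqP /half v00; rewrite vE v00 add0r.
Qed.

Lemma parmx2 : parmx *m parmx = 1%:M.
Proof.
apply: eq_mulmx_rV => v; rewrite mulmxA mulmx1.
have [v0 v1 {1 2}->] := evenoddP v; rewrite !mulmxDl.
rewrite !(gm_hom_parmx v0, gm_hom_parmx v1) -!scalemxAl.
rewrite !(gm_hom_parmx v0, gm_hom_parmx v1) !scalerA /Zsign /=.
by rewrite mulr1 mulrNN mulr1 !scale1r.
Qed.

(** The operator of a symbol shifts degrees by the degree of [x], but a vector
    homogeneous for the grading need not stay so under conjugation of its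
    coordinates; hence the conjugate of [parmx] on the right. *)
Lemma opmx_parmx i x g : ccl_homog i x ->
  opmx x g *m parmx = Zsign R i *: (Kmx (mg_phi g) parmx *m opmx x g).
Proof.
move=> xi; have symb_homog : magalg_homog i (symb x g).
  move=> h; rewrite ffunE; case: ifP => // _.
  by split; exact: cl_homog0.
have homE j (v : 'rV_n) : gm_hom j v -> Kmx (mg_phi g) v *m opmx x g *m parmx =
    Kmx (mg_phi g) v *m (Zsign R i *: (Kmx (mg_phi g) parmx *m opmx x g)).
  move=> hv; rewrite -gm_act_symb (gm_hom_parmx (gm_hom_act symb_homog hv)).
  rewrite -scalemxAr mulmxA -map_mxM (gm_hom_parmx hv) map_mxZ /= Kpow_sign.
  by rewrite -scalemxAl scalerA ZsignD gm_act_symb.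
apply: eq_mulmx_rV => v; rewrite -(KmxK (mg_phi g) v) mulmxA.
have [v0 v1 ->] := evenoddP (Kmx (mg_phi g) v).
by rewrite map_mxD !mulmxDl (homE _ _ v0) (homE _ _ v1).
Qed.

Definition ops_of : ops R G (p + q) n :=
  Ops (fun j => opmx (re_ccl (cl_gen R j)) 1%g) (fun g => opmx 1 g) parmx.

Lemma ops_of_rep : is_rep ops_of.
Proof.
split=> /=.
- move=> j; rewrite -opmx1M -re_cclM cl_gen_square.
  case: ifP => _; first exact: opmx1.
  by rewrite re_cclN opmxN [opmx _ _]opmx1 raddfN.
- move=> j k jk; rewrite -!opmx1M -!re_cclM cl_gen_anticomm 1?eq_sym //.
  by rewrite re_cclN opmxN.
- exact: parmx2.
- move=> j; rewrite (@opmx_parmx 1); last first.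
    by split=> /=; [exact: cl_homog_gen|exact: cl_homog0].
  by rewrite mg_phi1 Kmx0 /Zsign /= scaleN1r.
- exact: opmx1.
- by move=> g h; rewrite -opmxM ccl_Kpow1 mulr1.
- move=> g j; rewrite -opmxM ccl_Kpow_re mul1r mulg1.
  by rewrite -opmx1M mulr1.
- move=> g; rewrite (@opmx_parmx 0) ?scale1r //.
  by split; [exact: cl_homog_scal|exact: cl_homog0].
Qed.

End OperatorsOfModule.

Definition intertwines (R : realType) (G : magneticGroup) (m n n' : nat)
    (O : ops R G m n) (O' : ops R G m n') (S : 'M[R[i]]_(n, n')) : Prop :=
  (forall j, o_gen O j *m S = S *m o_gen O' j) /\
  (forall g, o_act O g *m S = Kmx (mg_phi g) S *m o_act O' g).

Definition even_mx (R : realType) (G : magneticGroup) (m n n' : nat)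
    (O : ops R G m n) (O' : ops R G m n') (S : 'M[R[i]]_(n, n')) : Prop :=
  o_par O *m S = S *m o_par O'.

Section HomIntertwines.
Context (R : realType) (G : magneticGroup) (p q : nat).
Variables (E F : gmod R G p q).
Implicit Type S : 'M[R[i]]_(gm_dim E, gm_dim F).

Lemma is_hom_opmx S x g : is_hom S ->
  opmx E x g *m S = Kmx (mg_phi g) S *m opmx F x g.
Proof.
move=> hS; apply: eq_mulmx_rV => v; rewrite -(KmxK (mg_phi g) v).
by rewrite !mulmxA -gm_act_symb hS gm_act_symb map_mxM.
Qed.

(** The generators and the group elements, together with the complex scalars,
    generate the algebra. *)
Lemma is_hom_intertwines S : is_hom S <-> intertwines (ops_of E) (ops_of F) S.
Proof.
split=> [hS|[hgen hact]].
  by split=> [j|g]; rewrite /= is_hom_opmx // mg_phi1 Kmx0.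
have hcl (x : clifford R p q) :
    opmx E (re_ccl x) 1%g *m S = S *m opmx F (re_ccl x) 1%g.
  elim/cl_ind: x => x; elim: x => [a|j|x IHx y IHy|x IHx y IHy].
  - have -> : re_ccl (cl_class (ClScal p q a)) = ccl_scal p q a%:C by [].
    by rewrite !opmx_scal scalar_mxC.
  - exact: hgen.
  - rewrite -cl_addE.
    have -> : re_ccl (cl_class x + cl_class y) =
      re_ccl (cl_class x) + re_ccl (cl_class y) by congr pair; rewrite addr0.
    by rewrite !opmxD mulmxDl mulmxDr IHx IHy.
  - by rewrite -cl_mulE re_cclM !opmx1M -mulmxA IHx !mulmxA IHy.
have hccl (x : ccliff R p q) : opmx E x 1%g *m S = S *m opmx F x 1%g.
  have -> : x = re_ccl x.1 + ccl_scal p q (0 +i* 1) * re_ccl x.2.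
    case: x => x y; congr pair; rewrite /= cl_scal0 cl_scal1;
      by rewrite !(mulr0, mul0r, mul1r, subr0, addr0, add0r).
  rewrite !opmxD !opmx1M !opmx_scal mulmxDl mulmxDr hcl -mulmxA -scalar_mxC.
  by rewrite !mulmxA hcl.
have hsymb (x : ccliff R p q) g :
    opmx E x g *m S = Kmx (mg_phi g) S *m opmx F x g.
  rewrite -[x]mulr1 !opmx1M -mulmxA hccl mulmxA.
  by rewrite (hact g) mulmxA.
move=> a v; rewrite [a]magalg_sum_symb.
have gm_act_sum (H : gmod R G p q) (w : 'rV_(gm_dim H)) :
    gm_act (\sum_g symb (a g) g) w = \sum_g gm_act (symb (a g) g) w.
  have gm_act0l : gm_act (0 : magalg R G p q) w = 0.
    by apply: (addrI (gm_act 0 w)); rewrite -gm_actDl !addr0.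
  exact: (big_morph (fun b => gm_act b w) (@gm_actDl _ _ _ _ H w) gm_act0l).
rewrite !gm_act_sum mulmx_suml; apply: eq_bigr => g _.
by rewrite !gm_act_symb -mulmxA hsymb map_mxM mulmxA.
Qed.

Lemma is_deg0_even S : is_deg0 S <-> even_mx (ops_of E) (ops_of F) S.
Proof.
split=> [hS|hS i v hv]; rewrite /even_mx /=.
  apply: eq_mulmx_rV => v; have [v0 v1 ->] := evenoddP v; rewrite !mulmxDl.
  rewrite !mulmxA (gm_hom_parmx v0) (gm_hom_parmx v1) -!scalemxAl.
  by rewrite (gm_hom_parmx (hS _ _ v0)) (gm_hom_parmx (hS _ _ v1)).
apply: parmx_gm_hom; rewrite -mulmxA -hS mulmxA (gm_hom_parmx hv).
by rewrite scalemxAl.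
Qed.

End HomIntertwines.

(** Recovering the operators of the module built from a system of operators
    lets every later statement be checked on operators alone. *)
Lemma gmod_ofK (R : realType) (G : magneticGroup) (p q n : nat)
    (O : ops R G (p + q) n) (repO : is_rep O) : ops_of (gmod_of repO) = O.
Proof.
have opE x g : opmx (gmod_of repO) x g = o_act O g *m ccev O x.
  apply: eq_mulmx_rV => v.
  rewrite (@mul_opmx _ _ _ _ (gmod_of repO)) [LHS]o_mact_symb //.
  by rewrite [Kmx _ _](KmxK (mg_phi g) (v : 'rV_n)) mulmxA.
case: O repO opE => gen act par repO opE; congr Ops.
- apply: funext => j; rewrite opE (rep_act1 repO) mul1mx /ccev /= cev_gen //.
  by rewrite cev0 // scaler0 addr0.
- by apply: funext => g; rewrite opE [ccev _ _](ccev_scal repO 1) mulmx1.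
- apply: eq_mulmx_rV => v.
  have [v0 v1 vE] := @evenoddP _ _ _ _ (gmod_of repO) v.
  rewrite (@mul_parmx _ _ _ _ (gmod_of repO)) /parity [in RHS]vE mulmxDl.
  by rewrite [X in _ = X + _]v0 [X in _ = _ + X]v1 scale1r scaleN1r.
Qed.

(** * Extension: from a module to its four copies *)

Section Pauli.
Context (K : comNzRingType).

(** The Kronecker product with the Pauli-type matrix which exchanges the two
    copies if [b], and which has a sign on the second row if [c]. *)
Definition pauli (b c : bool) (m n : nat) (X : 'M[K]_(m, n)) :
    'M[K]_(m + m, n + n) :=
  if b then block_mx 0 X ((-1) ^+ c *: X) 0
  else block_mx X 0 0 ((-1) ^+ c *: X).

Arguments pauli : simpl never.

Lemma pauliM b c b' c' m n k (X : 'M_(m, n)) (Y : 'M_(n, k)) :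
  pauli b c X *m pauli b' c' Y =
  (-1) ^+ (b && c') *: pauli (b (+) b') (c (+) c') (X *m Y).
Proof.
rewrite /pauli; case: b; case: c; case: b'; case: c';
  rewrite mulmx_block !(mul0mx, mulmx0, addr0, add0r) /=;
  rewrite !(expr0, expr1, scale1r, scaleN1r);
  by rewrite ?(mulmxN, mulNmx, opprK, opp_block_mx, oppr0).
Qed.

Lemma pauliD b c m n : {morph @pauli b c m n : X Y / X + Y}.
Proof.
by move=> X Y; rewrite /pauli; case: b; rewrite add_block_mx ?addr0 scalerDr.
Qed.

Lemma pauliZ b c m n z (X : 'M_(m, n)) : pauli b c (z *: X) = z *: pauli b c X.
Proof.
by rewrite /pauli; case: b; rewrite scale_block_mx scaler0 !scalerA mulrC.
Qed.

Lemma pauli_scalar m z : pauli false false (z%:M : 'M_m) = z%:M.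
Proof. by rewrite /pauli expr0 scale1r -scalar_mx_block. Qed.

Lemma map_pauli (f : {rmorphism K -> K}) b c m n (X : 'M_(m, n)) :
  map_mx f (pauli b c X) = pauli b c (map_mx f X).
Proof.
by rewrite /pauli; case: b; rewrite map_block_mx map_mxZ rmorph_sign !map_mx0.
Qed.

Definition pauli2 b c b' c' m n (X : 'M[K]_(m, n)) :=
  pauli b c (pauli b' c' X).

Arguments pauli2 : simpl never.

Lemma pauli2M b c d e b' c' d' e' m n k (X : 'M_(m, n)) (Y : 'M_(n, k)) :
  pauli2 b c d e X *m pauli2 b' c' d' e' Y =
  (-1) ^+ ((b && c') (+) (d && e')) *:
    pauli2 (b (+) b') (c (+) c') (d (+) d') (e (+) e') (X *m Y).
Proof. by rewrite /pauli2 !pauliM pauliZ scalerA signr_addb. Qed.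

Lemma pauli2D b c d e m n : {morph @pauli2 b c d e m n : X Y / X + Y}.
Proof. by move=> X Y; rewrite /pauli2 !pauliD. Qed.

Lemma pauli2Z b c d e m n z (X : 'M_(m, n)) :
  pauli2 b c d e (z *: X) = z *: pauli2 b c d e X.
Proof. by rewrite /pauli2 !pauliZ. Qed.

Lemma pauli2N b c d e m n (X : 'M_(m, n)) :
  pauli2 b c d e (- X) = - pauli2 b c d e X.
Proof. by rewrite -scaleN1r pauli2Z scaleN1r. Qed.

Lemma pauli2_scalar m z :
  pauli2 false false false false (z%:M : 'M_m) = z%:M.
Proof. by rewrite /pauli2 !pauli_scalar. Qed.

Lemma pauli2_anticomm m (X Y : 'M_m) : X *m Y = - (Y *m X) ->
  pauli2 false false false true X *m pauli2 false false false true Y =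
  - (pauli2 false false false true Y *m pauli2 false false false true X).
Proof. by move=> XY; rewrite [LHS]pauli2M XY pauli2N scalerN -pauli2M. Qed.

Lemma map_pauli2 (f : {rmorphism K -> K}) b c d e m n (X : 'M_(m, n)) :
  map_mx f (pauli2 b c d e X) = pauli2 b c d e (map_mx f X).
Proof. by rewrite /pauli2 !map_pauli. Qed.

Lemma mul_row_pauli b c m n k (X Y : 'M_(m, n)) (Z : 'M_(n, k)) :
  row_mx X Y *m pauli b c Z =
  if b then row_mx ((-1) ^+ c *: (Y *m Z)) (X *m Z)
  else row_mx (X *m Z) ((-1) ^+ c *: (Y *m Z)).
Proof.
rewrite /pauli; case: b; rewrite mul_row_block !mulmx0 ?addr0 ?add0r;
  by rewrite -scalemxAr.
Qed.

Lemma mul_row_pauli2 b c d e m n k (X Y Z T : 'M_(m, n)) (U : 'M_(n, k)) :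
  row_mx (row_mx X Y) (row_mx Z T) *m pauli2 b c d e U =
  if b then row_mx ((-1) ^+ c *: (row_mx Z T *m pauli d e U))
                   (row_mx X Y *m pauli d e U)
  else row_mx (row_mx X Y *m pauli d e U)
              ((-1) ^+ c *: (row_mx Z T *m pauli d e U)).
Proof. exact: mul_row_pauli. Qed.

End Pauli.

Arguments pauli : simpl never.
Arguments pauli2 : simpl never.

Section GeneratorIndices.
Variables p q : nat.

(** [old_gen] keeps the value of the index, and therefore the sign of the square;
    the four new generators come last, hence have square -1. *)
Definition old_gen (j : 'I_(p + q)) : 'I_(p + (q + 4)) :=
  cast_ord (esym (addnA p q 4)) (lshift 4 j).
Definition new_gen (k : 'I_4) : 'I_(p + (q + 4)) :=
  cast_ord (esym (addnA p q 4)) (rshift (p + q) k).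
Definition gen_split (j : 'I_(p + (q + 4))) : 'I_(p + q) + 'I_4 :=
  split (cast_ord (addnA p q 4) j).

Lemma gen_split_old j : gen_split (old_gen j) = inl j.
Proof. by rewrite /gen_split cast_ordKV (unsplitK (inl j)). Qed.

Lemma gen_split_new k : gen_split (new_gen k) = inr k.
Proof. by rewrite /gen_split cast_ordKV (unsplitK (inr k)). Qed.

Lemma gen_cases (P : 'I_(p + (q + 4)) -> Prop) :
  (forall j, P (old_gen j)) -> (forall k, P (new_gen k)) -> forall j, P j.
Proof.
move=> Pold Pnew j; rewrite -(cast_ordK (addnA p q 4) j).
rewrite -(splitK (cast_ord _ j)); case: (split _) => k /=.
  exact: Pold.
exact: Pnew.
Qed.

Lemma new_gen_ge k : (new_gen k < p)%N = false.
Proof. by apply/negbTE; rewrite -leqNgt /= -addnA leq_addr. Qed.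

Lemma val_old_gen j : old_gen j = j :> nat.
Proof. by []. Qed.

Lemma old_gen_inj : injective old_gen.
Proof. by move=> j j' /(congr1 gen_split); rewrite !gen_split_old => -[]. Qed.

Lemma new_gen_inj : injective new_gen.
Proof. by move=> j j' /(congr1 gen_split); rewrite !gen_split_new => -[]. Qed.

Lemma old_new_gen j k : old_gen j != new_gen k.
Proof.
by apply/eqP => /(congr1 gen_split); rewrite gen_split_old gen_split_new.
Qed.

End GeneratorIndices.

Definition phib (G : magneticGroup) (g : G) : bool := mg_phi g != 0.

Lemma phibM (G : magneticGroup) (g h : G) :
  phib (g * h)%g = phib g (+) phib h.
Proof.
rewrite /phib mg_phiM.
by case: (Z2_cases (mg_phi g)) (Z2_cases (mg_phi h)) => -> [] ->.
Qed.

Lemma phib1 (G : magneticGroup) : phib (1%g : G) = false.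
Proof. by rewrite /phib mg_phi1. Qed.

(** The sign is the pullback of [sigma], so that [lam] exhibits it as a
    coboundary. *)
Definition is_trivialisation (R : realType) (G : magneticGroup)
    (lam : G -> R[i]) : Prop :=
  (forall g, lam g != 0) /\
  forall g h, (-1) ^+ (phib g && phib h) * lam (g * h)%g =
    lam g * Kpow (mg_phi g) (lam h).

Lemma trivialisation_exists (R : realType) (G : magneticGroup) :
  same_H2_class (phi_sigma R G) (fun _ _ => 1) ->
  exists lam : G -> R[i], is_trivialisation lam.
Proof.
move=> [lam lam0 lamE]; exists lam; split=> // g h.
have <- : phi_sigma R G g h = (-1) ^+ (phib g && phib h).
  rewrite /phi_sigma sigmaE /phib.
  by case: (Z2_cases (mg_phi g)) (Z2_cases (mg_phi h)) => -> [] ->.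
by have := lamE g h; rewrite divr1 => ->; rewrite divfK.
Qed.

Lemma Kpow_sign_i (R : realType) (G : magneticGroup) (g : G) :
  Kpow (mg_phi g) 'i = (-1) ^+ phib g * 'i :> R[i].
Proof. by rewrite Kpow_i /Zsign /phib; case: ifP. Qed.

Section Extension.
Context (R : realType) (G : magneticGroup) (p q : nat) (lam : G -> R[i]).
Hypothesis lamP : is_trivialisation lam.

Lemma triv1 : lam 1%g = 1.
Proof.
have [lam0 /(_ 1%g 1%g)] := lamP; rewrite phib1 expr0 mul1r mulg1 mg_phi1 Kpow0.
by rewrite -[X in X = _]mulr1 => /(mulfI (lam0 _)).
Qed.

(** On the outer and inner copies the new generators are the products of J and
    eps, of each of the other two Pauli matrices, times the imaginary unit, and
    eps, and of 1 and f.  Then e1 e2 is the imaginary unit times a diagonal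
    sign, and e2 e3 is J. *)
Definition new_coef (k : 'I_4) : R[i] := [:: 1; 'i; 'i; 1]`_k.
Definition new_bits (k : 'I_4) : bool * bool * bool * bool :=
  nth (false, false, false, false)
   [:: (true, true, true, false); (true, false, true, false);
       (false, true, true, false); (false, false, true, true)] k.

Definition new_mx n (k : 'I_4) : 'M[R[i]]_((n + n) + (n + n)) :=
  let: (b, c, d, e) := new_bits k in
  new_coef k *: pauli2 b c d e (1%:M : 'M_n).

(** The operators on four copies.  An antilinear element also exchanges the
    outer copies by J, which undoes the effect of conjugation on the new
    generators. *)
Definition ext_ops n (O : ops R G (p + q) n) :
    ops R G (p + (q + 4)) ((n + n) + (n + n)) :=
  Ops (fun j => match gen_split j with
        | inl i => pauli2 false false false true (o_gen O i)
        | inr k => new_mx n k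
        end)
      (fun g => lam g *: pauli2 (phib g) (phib g) false false (o_act O g))
      (pauli2 false false false true (o_par O)).

Lemma ext_ops_old n (O : ops R G (p + q) n) j :
  o_gen (ext_ops O) (old_gen j) = pauli2 false false false true (o_gen O j).
Proof. by rewrite /= gen_split_old. Qed.

Lemma ext_ops_new n (O : ops R G (p + q) n) k :
  o_gen (ext_ops O) (new_gen p q k) = new_mx n k.
Proof. by rewrite /= gen_split_new. Qed.

Lemma new_mx_sq n k : new_mx n k *m new_mx n k = - 1%:M.
Proof.
have ii : 'i * 'i = -1 :> R[i] by rewrite -expr2 sqr_i.
case: k => [[|[|[|[|k]]]] ltk4] //=; rewrite /new_mx /new_bits /new_coef /=;
  rewrite -scalemxAl -scalemxAr pauli2M mulmx1 /= pauli2_scalar !scalerA ?ii;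
  by rewrite ?mul1r ?expr0 ?expr1 ?mulr1 ?scaleN1r.
Qed.

(** The sign of a product of Pauli matrices depends on the bits alone, so that
    anticommutation is a finite check. *)
Lemma new_mx_anti n k l : k != l ->
  new_mx n k *m new_mx n l = - (new_mx n l *m new_mx n k).
Proof.
move=> kl; have : forall k l : 'I_4, k != l ->
    let: (b, c, d, e) := new_bits k in let: (b', c', d', e') := new_bits l in
    (b && c') (+) (d && e') = ~~ ((b' && c) (+) (d' && e)).
  by case=> [[|[|[|[|?]]]] ?] [[|[|[|[|?]]]] ?].
move=> /(_ k l kl); rewrite /new_mx.
case: (new_bits k) (new_bits l) => [[[b c] d] e] [[[b' c'] d'] e'] sgn.
rewrite -!(scalemxAl, scalemxAr) !pauli2M sgn mulmx1 !scalerA -scaleNr.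
rewrite [b' (+) b]addbC [c' (+) c]addbC [d' (+) d]addbC [e' (+) e]addbC.
by rewrite signrN mulrN [new_coef l * _]mulrC.
Qed.

Lemma new_mx_old n k (X : 'M[R[i]]_n) :
  pauli2 false false false true X *m new_mx n k =
  - (new_mx n k *m pauli2 false false false true X).
Proof.
have : (new_bits k).1.2 = true by case: k => [[|[|[|[|?]]]] ?].
rewrite /new_mx; case: (new_bits k) => [[[b c] d] e] /= ->.
rewrite -!(scalemxAl, scalemxAr) !pauli2M mulmx1 mul1mx andbF.
rewrite !scalerA -scaleNr [b (+) _]addbC [c (+) _]addbC [_ (+) true]addbC.
by rewrite [e (+) _]addbC /= expr1 mulrN1 opprK mulr1.
Qed.

(** The coefficient is imaginary exactly when the outer Pauli matrix
    anticommutes with J. *)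
Lemma Kpow_new_coef k (g : G) :
  let: (b, c, d, e) := new_bits k in
  Kpow (mg_phi g) (new_coef k) = (-1) ^+ (phib g && (b (+) c)) * new_coef k.
Proof.
by case: k => [[|[|[|[|?]]]] ?] //=; rewrite /new_coef /= ?andbF ?andbT;
  rewrite ?Kpow_sign_i // rmorph1 expr0 mulr1.
Qed.

Lemma new_mx_act n k (g : G) (X : 'M[R[i]]_n) :
  Kmx (mg_phi g) (new_mx n k) *m pauli2 (phib g) (phib g) false false X =
  pauli2 (phib g) (phib g) false false X *m new_mx n k.
Proof.
have := Kpow_new_coef k g; rewrite /new_mx.
case: (new_bits k) => [[[b c] d] e] coefE.
rewrite map_mxZ map_pauli2 map_mx1 -scalemxAl -scalemxAr !pauli2M.
rewrite mulmx1 mul1mx !scalerA; congr (_ *: pauli2 _ _ _ _ _);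
  try by rewrite addbC.
rewrite [LHS](congr1 (fun z => z * _) coefE) {coefE} mulrC mulrA -signr_addb mulrC.
by congr (_ * (-1) ^+ nat_of_bool _); case: b c d (phib g) => [] [] [] [].
Qed.

(** The sign in the product of two copies of J is the one that [lam] absorbs. *)
Lemma ext_ops_rep n (O : ops R G (p + q) n) : is_rep O -> is_rep (ext_ops O).
Proof.
move=> repO; split.
- elim/gen_cases=> [j|k]; rewrite ?ext_ops_old ?ext_ops_new.
    by rewrite pauli2M /= expr0 scale1r (rep_sq repO) pauli2_scalar.
  by rewrite new_mx_sq new_gen_ge raddfN.
- elim/gen_cases=> [j|k]; elim/gen_cases=> [j'|k']; rewrite ?ext_ops_old ?ext_ops_new.
  + rewrite (inj_eq (@old_gen_inj _ _)) => jj'.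
    by apply: pauli2_anticomm; exact: (rep_anti repO jj').
  + by move=> _; exact: new_mx_old.
  + by move=> _; rewrite new_mx_old opprK.
  + by rewrite (inj_eq (@new_gen_inj _ _)); exact: new_mx_anti.
- by rewrite pauli2M /= expr0 scale1r (rep_par2 repO) pauli2_scalar.
- elim/gen_cases=> [j|k]; rewrite ?ext_ops_old ?ext_ops_new /=.
    by apply: pauli2_anticomm; exact: (rep_gen_par repO).
  by rewrite new_mx_old opprK.
- by rewrite /= triv1 phib1 (rep_act1 repO) scale1r pauli2_scalar.
- move=> g h /=; rewrite map_mxZ map_pauli2 -scalemxAl -scalemxAr scalerA pauli2M.
  rewrite /= addbF scalerA (rep_actM repO) phibM [in RHS]addbC.
  rewrite [phib g (+) _]addbC; congr (_ *: _).
  have [_ lamM] := lamP; rewrite mulrC [X in _ * X]mulrC -lamM mulrA.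
  by rewrite andbC -expr2 sqrr_sign mul1r.
- move=> g; elim/gen_cases=> [j|k]; rewrite ?ext_ops_old ?ext_ops_new /=.
    rewrite map_pauli2 -scalemxAl -scalemxAr 2!pauli2M (rep_act_gen repO) /=.
    by rewrite !andbF addbF /= addbC.
  by rewrite -scalemxAl -scalemxAr new_mx_act.
- move=> g /=; rewrite map_pauli2 -scalemxAl -scalemxAr 2!pauli2M.
  by rewrite (rep_act_par repO) /= !andbF addbF /= addbC.
Qed.

Definition ext_mx n n' (S : 'M[R[i]]_(n, n')) := pauli2 false false false false S.

Lemma ext_mx_intertwines n n' (O : ops R G (p + q) n) (O' : ops R G (p + q) n')
    S : intertwines O O' S -> intertwines (ext_ops O) (ext_ops O') (ext_mx S).
Proof.
move=> [hgen hact]; split.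
  elim/gen_cases=> [j|k]; rewrite ?ext_ops_old ?ext_ops_new.
    by rewrite 2!pauli2M hgen.
  rewrite /new_mx; case: (new_bits k) => [[[b c] d] e].
  rewrite -scalemxAl -scalemxAr 2!pauli2M mulmx1 mul1mx /=.
  by rewrite !andbF !addbF.
move=> g; rewrite /= map_pauli2 -scalemxAl -scalemxAr 2!pauli2M hact.
by rewrite !andbF !addbF.
Qed.

Lemma ext_mx_even n n' (O : ops R G (p + q) n) (O' : ops R G (p + q) n') S :
  even_mx O O' S -> even_mx (ext_ops O) (ext_ops O') (ext_mx S).
Proof. by move=> hS; rewrite /even_mx !pauli2M hS. Qed.

End Extension.

(** * The quaternionic corner *)

Section HalfProjections.
Context (K : numFieldType).

(** For an involution [s], the projection onto its eigenvalue [(-1) ^+ b]. *)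
Definition halfproj (b : bool) n (s : 'M[K]_n) : 'M[K]_n :=
  2^-1 *: (1%:M + (-1) ^+ b *: s).

Lemma halfproj_comm b (c : bool) m n (s : 'M_m) (t : 'M_n) (X : 'M_(m, n)) :
  s *m X = (-1) ^+ c *: (X *m t) ->
  halfproj b s *m X = X *m halfproj (b (+) c) t.
Proof.
move=> sX; rewrite /halfproj -scalemxAl -scalemxAr mulmxDl mulmxDr mul1mx mulmx1.
by rewrite -scalemxAl -scalemxAr sX scalerA signr_addb.
Qed.

Lemma halfproj_sum n (s : 'M[K]_n) : halfproj false s + halfproj true s = 1%:M.
Proof.
rewrite /halfproj -scalerDr expr0 expr1 scale1r scaleN1r addrACA subrr addr0.
exact: scale_half.
Qed.

Lemma mul_sign_halfproj b n (s : 'M[K]_n) : s *m s = 1%:M ->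
  s *m halfproj b s = (-1) ^+ b *: halfproj b s.
Proof.
move=> ss; rewrite /halfproj -scalemxAr mulmxDr mulmx1 -scalemxAr ss.
rewrite scalerA [_ * 2^-1]mulrC -scalerA; congr (_ *: _).
by rewrite scalerDr scalerA -expr2 sqrr_sign scale1r addrC.
Qed.

Lemma halfprojM b b' n (s : 'M[K]_n) : s *m s = 1%:M ->
  halfproj b s *m halfproj b' s = (b == b')%:R *: halfproj b s.
Proof.
move=> ss; rewrite {1}/halfproj -scalemxAl mulmxDl mul1mx -scalemxAl mul_sign_halfproj //.
rewrite scalerA -signr_addb.
case: b b' => [] []; rewrite /= ?expr0 ?expr1 ?scale1r ?scale0r ?scaleN1r;
  by rewrite ?subrr ?scaler0 ?scale_half.
Qed.

Lemma map_halfproj (f : {rmorphism K -> K}) b n (s : 'M_n) :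
  map_mx f (halfproj b s) = halfproj b (map_mx f s).
Proof.
by rewrite map_mxZ map_mxD map_mx1 map_mxZ rmorph_sign fmorphV rmorph_nat.
Qed.

End HalfProjections.

(** [S] and [A] are the commuting involutions that cut out the corner; [J] and
    [Eps] are units, each reversing exactly one of them, so that they permute
    the four joint eigenspaces simply transitively. *)
Record is_frame (K : numClosedFieldType) n (S A J Eps : 'M[K]_n) : Prop := {
  frame_S2 : S *m S = 1%:M;
  frame_A2 : A *m A = 1%:M;
  frame_J2 : J *m J = - 1%:M;
  frame_Eps2 : Eps *m Eps = 1%:M;
  frame_SA : S *m A = A *m S;
  frame_SJ : S *m J = - (J *m S);
  frame_SEps : S *m Eps = Eps *m S;
  frame_AJ : A *m J = J *m A;
  frame_AEps : A *m Eps = - (Eps *m A);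
  frame_JEps : J *m Eps = Eps *m J }.

Section Corner.
Context (K : numClosedFieldType) (n : nat) (S A J Eps : 'M[K]_n).
Hypothesis frame : is_frame S A J Eps.

Let S2 := frame_S2 frame.
Let A2 := frame_A2 frame.
Let J2 := frame_J2 frame.
Let Eps2 := frame_Eps2 frame.
Let SA := frame_SA frame.
Let SJ := frame_SJ frame.
Let SEps := frame_SEps frame.
Let AJ := frame_AJ frame.
Let AEps := frame_AEps frame.
Let JEps := frame_JEps frame.

Definition cornerP (b c : bool) := halfproj b S *m halfproj c A.
Definition corner := cornerP false false.

Lemma cornerP_J b c : cornerP b c *m J = J *m cornerP (~~ b) c.
Proof.
have hS : S *m J = (-1) ^+ true *: (J *m S).
  by rewrite expr1 scaleN1r SJ.
have hA : A *m J = (-1) ^+ false *: (J *m A).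
  by rewrite expr0 scale1r AJ.
rewrite /cornerP -mulmxA (halfproj_comm c hA) mulmxA (halfproj_comm b hS).
by rewrite addbT addbF mulmxA.
Qed.

Lemma cornerP_Eps b c : cornerP b c *m Eps = Eps *m cornerP b (~~ c).
Proof.
have hS : S *m Eps = (-1) ^+ false *: (Eps *m S).
  by rewrite expr0 scale1r SEps.
have hA : A *m Eps = (-1) ^+ true *: (Eps *m A).
  by rewrite expr1 scaleN1r AEps.
rewrite /cornerP -mulmxA (halfproj_comm c hA) mulmxA (halfproj_comm b hS).
by rewrite addbT addbF mulmxA.
Qed.

Lemma cornerPM b c b' c' : cornerP b c *m cornerP b' c' =
  ((b == b') && (c == c'))%:R *: cornerP b c.
Proof.
have hSA : S *m A = (-1) ^+ false *: (A *m S).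
  by rewrite expr0 scale1r SA.
have hA : A *m halfproj b' S = (-1) ^+ false *: (halfproj b' S *m A).
  by rewrite expr0 scale1r (halfproj_comm b' hSA) addbF.
rewrite /cornerP -mulmxA [X in _ *m X]mulmxA (halfproj_comm c hA) addbF.
rewrite -mulmxA mulmxA (halfprojM b b' S2) (halfprojM c c' A2).
rewrite -scalemxAl -scalemxAr scalerA -natrM; congr (_%:R *: _).
by case: eqP; case: eqP.
Qed.

Lemma cornerP_sum : cornerP false false + cornerP false true +
  cornerP true false + cornerP true true = 1%:M.
Proof.
rewrite /cornerP -addrA -!mulmxDr halfproj_sum !mulmx1.
exact: halfproj_sum.
Qed.

Section Splitting.
Variables (r : nat) (B : 'M[K]_(r, n)) (C : 'M[K]_(n, r)).
Hypotheses (CB : C *m B = corner) (BC : B *m C = 1%:M).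

Lemma corner_mul : corner *m C = C. Proof. by rewrite -CB -mulmxA BC mulmx1. Qed.
Lemma mul_corner : B *m corner = B. Proof. by rewrite -CB mulmxA BC mul1mx. Qed.

Let PC b c : cornerP b c *m C = (~~ b && ~~ c)%:R *: C.
Proof.
rewrite -{1}corner_mul mulmxA cornerPM -scalemxAl.
by case: b; case: c; rewrite /= ?scale0r ?corner_mul.
Qed.

Let BXC0 b c (X : 'M[K]_n) : (b || c) -> corner *m X = X *m cornerP b c ->
  B *m (X *m C) = 0.
Proof.
move=> bc eX; rewrite -mul_corner -mulmxA [corner *m _]mulmxA eX -[X *m _ *m C]mulmxA.
by rewrite PC; move: bc; case: b c {eX} => [] [] //= _; rewrite scale0r !mulmx0.
Qed.

Let BJC : B *m (J *m C) = 0.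
Proof. exact: (BXC0 _ (cornerP_J false false)). Qed.
Let BEpsC : B *m (Eps *m C) = 0.
Proof. exact: (BXC0 _ (cornerP_Eps false false)). Qed.
Let BJEpsC : B *m (J *m (Eps *m C)) = 0.
Proof.
rewrite [J *m _]mulmxA; apply: (@BXC0 true true) => //.
rewrite [LHS]mulmxA [X in X *m _](cornerP_J false false) -[LHS]mulmxA.
by rewrite cornerP_Eps [LHS]mulmxA.
Qed.

(** [spread] collects the components of a vector in the four translates
    [C], [C Eps], [C J] and [C J Eps] of the corner, brought back to it; the
    signs come from the inverse [- J] of [J].  [gather] is its inverse. *)
Definition spread : 'M[K]_(n, (r + r) + (r + r)) :=
  row_mx (row_mx C (Eps *m C))
         (row_mx (- (J *m C)) (- (J *m (Eps *m C)))).

Definition gather : 'M[K]_((r + r) + (r + r), n) :=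
  col_mx (col_mx B (B *m Eps))
         (col_mx (B *m J) (B *m J *m Eps)).

(** The four conjugates of the corner by 1, Eps, J and J Eps are the four joint
    eigenprojections, whose sum is the identity. *)
Lemma spreadK : spread *m gather = 1%:M.
Proof.
have JJ X : J *m (J *m X) = - X :> 'M_n by rewrite mulmxA J2 mulNmx mul1mx.
have EE X : Eps *m (Eps *m X) = X :> 'M_n by rewrite mulmxA Eps2 mul1mx.
have EJ X : Eps *m (J *m X) = J *m (Eps *m X) :> 'M_n by rewrite !mulmxA JEps.
have CBX m (X : 'M_(n, m)) : C *m (B *m X) = corner *m X by rewrite mulmxA CB.
have eE : corner *m Eps = Eps *m cornerP false true := cornerP_Eps _ _.
have eJ : corner *m J = J *m cornerP true false := cornerP_J _ _.
have eJE : corner *m (J *m Eps) = J *m (Eps *m cornerP true true).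
  by rewrite [LHS]mulmxA eJ -[LHS]mulmxA cornerP_Eps.
rewrite /spread /gather !mul_row_col !mulNmx -!mulmxA CB !CBX eE eJ eJE.
by rewrite EE EJ EE !JJ !opprK -cornerP_sum !addrA.
Qed.

Lemma gatherK : gather *m spread = 1%:M.
Proof.
have JJ X : J *m (J *m X) = - X :> 'M_(n, r).
  by rewrite mulmxA J2 mulNmx mul1mx.
have EE X : Eps *m (Eps *m X) = X :> 'M_(n, r).
  by rewrite mulmxA Eps2 mul1mx.
have EJ X : Eps *m (J *m X) = J *m (Eps *m X) :> 'M_(n, r).
  by rewrite !mulmxA JEps.
rewrite /spread /gather !mul_col_mx !mul_mx_row !mulmxN -!mulmxA.
rewrite !(EJ, EE, JJ) !mulmxN !(BC, BJC, BEpsC, BJEpsC) !oppr0 !opprK.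
(* Both sides are brought to the shape of nested block matrices. *)
have colrow (a b c d : 'M[K]_(r, r + r)) :
    col_mx (row_mx a c) (row_mx b d) = row_mx (col_mx a b) (col_mx c d).
  exact: block_mxEh.
by rewrite row_mx0 !colrow col_mx0 !scalar_mx_block.
Qed.

End Splitting.

End Corner.

Section FourAnticommuting.
Context (K : numClosedFieldType) (n : nat).
Variable E : nat -> 'M[K]_n.

(** From four anticommuting square roots [E k] of -1: [opI] and [opJ] generate
    the quaternions, [opEps] and [E 3] the commuting factor.  The involution
    [opS] is 1 where [opI] acts as the imaginary unit. *)
Definition opI := E 0 *m E 1.
Definition opJ := E 1 *m E 2.
Definition opEps := - (E 0 *m (E 1 *m E 2)).
Definition opA := E 0 *m (E 1 *m (E 2 *m E 3)).
Definition opS := - 'i *: opI.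

Hypothesis E_sq : forall k, E k *m E k = - 1%:M.
Hypothesis E_anti : forall k l, (k < 4)%N -> (l < 4)%N -> k != l ->
  E k *m E l = - (E l *m E k).

Let E_sqX m k (X : 'M_(n, m)) : E k *m (E k *m X) = - X.
Proof. by rewrite mulmxA E_sq mulNmx mul1mx. Qed.

Let E_antiX m k l (X : 'M_(n, m)) : (k < 4)%N -> (l < 4)%N -> k != l ->
  E k *m (E l *m X) = - (E l *m (E k *m X)).
Proof. by move=> *; rewrite mulmxA E_anti // mulNmx mulmxA. Qed.

Let E10 := @E_anti 1 0 isT isT isT.
Let E20 := @E_anti 2 0 isT isT isT.
Let E30 := @E_anti 3 0 isT isT isT.
Let E21 := @E_anti 2 1 isT isT isT.
Let E31 := @E_anti 3 1 isT isT isT.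
Let E32 := @E_anti 3 2 isT isT isT.
Let E10X m X := @E_antiX m 1 0 X isT isT isT.
Let E20X m X := @E_antiX m 2 0 X isT isT isT.
Let E30X m X := @E_antiX m 3 0 X isT isT isT.
Let E21X m X := @E_antiX m 2 1 X isT isT isT.
Let E31X m X := @E_antiX m 3 1 X isT isT isT.
Let E32X m X := @E_antiX m 3 2 X isT isT isT.

(* Sorts a monomial in the [E k] by the Clifford relations. *)
Let sortE := (E10, E20, E30, E21, E31, E32, E10X, E20X, E30X, E21X, E31X, E32X,
  E_sq, E_sqX, mulmxN, mulNmx, (@opprK 'M[K]_n), (@mulmx1 K n n)).

Lemma opI2 : opI *m opI = - 1%:M.
Proof. by rewrite /opI -!mulmxA !sortE. Qed.
Lemma opJ2 : opJ *m opJ = - 1%:M.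
Proof. by rewrite /opJ -!mulmxA !sortE. Qed.
Lemma opEps2 : opEps *m opEps = 1%:M.
Proof. by rewrite /opEps mulmxN mulNmx -!mulmxA !sortE. Qed.
Lemma opA2 : opA *m opA = 1%:M.
Proof. by rewrite /opA -!mulmxA !sortE. Qed.
Lemma opIJ : opI *m opJ = - (opJ *m opI).
Proof. by rewrite /opI /opJ -!mulmxA !sortE. Qed.
Lemma opIEps : opI *m opEps = opEps *m opI.
Proof. by rewrite /opI /opEps mulmxN mulNmx -!mulmxA !sortE. Qed.
Lemma opJEps : opJ *m opEps = opEps *m opJ.
Proof. by rewrite /opJ /opEps mulmxN mulNmx -!mulmxA !sortE. Qed.
Lemma opIA : opI *m opA = opA *m opI.
Proof. by rewrite /opI /opA -!mulmxA !sortE. Qed.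
Lemma opJA : opJ *m opA = opA *m opJ.
Proof. by rewrite /opJ /opA -!mulmxA !sortE. Qed.
Lemma opAEps : opA *m opEps = - (opEps *m opA).
Proof. by rewrite /opEps /opA mulmxN mulNmx -!mulmxA !sortE. Qed.

Lemma E0E : E 0 = opEps *m opJ.
Proof. by rewrite /opEps /opJ mulNmx -!mulmxA !sortE. Qed.
Lemma E1E : E 1 = - (opEps *m opJ *m opI).
Proof. by rewrite /opEps /opJ /opI !mulNmx -!mulmxA !sortE. Qed.
Lemma E2E : E 2 = opI *m opEps.
Proof. by rewrite /opEps /opI mulmxN -!mulmxA !sortE. Qed.
Lemma E3E : E 3 = - (opEps *m opA).
Proof. by rewrite /opEps /opA mulNmx -!mulmxA !sortE. Qed.

Lemma opS2 : opS *m opS = 1%:M.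
Proof.
rewrite /opS -scalemxAl -scalemxAr opI2 scalerA mulrNN -expr2 sqrCi.
by rewrite scaleN1r opprK.
Qed.
Lemma opSJ : opS *m opJ = - (opJ *m opS).
Proof. by rewrite /opS -scalemxAl -scalemxAr opIJ scalerN. Qed.
Lemma opSEps : opS *m opEps = opEps *m opS.
Proof. by rewrite /opS -scalemxAl -scalemxAr opIEps. Qed.
Lemma opSA : opS *m opA = opA *m opS.
Proof. by rewrite /opS -scalemxAl -scalemxAr opIA. Qed.
Lemma opIS : opI = 'i *: opS.
Proof. by rewrite /opS scalerA mulrN -expr2 sqrCi opprK scale1r. Qed.

Lemma four_frame : is_frame opS opA opJ opEps.
Proof.
split; [exact: opS2|exact: opA2|exact: opJ2|exact: opEps2|exact: opSA
  |exact: opSJ|exact: opSEps| |exact: opAEps|exact: opJEps].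
by rewrite opJA.
Qed.

End FourAnticommuting.

(** * Restriction: from a module to its corner *)

Section SignCommutation.
Context (K : numClosedFieldType).

(** Commutation up to sign across a rectangular [X].  It covers module maps,
    the matrices of group elements and the old generators at once. *)
Definition scomm (b : bool) m n (A : 'M[K]_m) (X : 'M[K]_(m, n)) (A' : 'M[K]_n) :=
  A *m X = (-1) ^+ b *: (X *m A').

Lemma eq_scomm b m n (A B : 'M_m) (X : 'M_(m, n)) (A' B' : 'M_n) :
  A = B -> A' = B' -> scomm b B X B' -> scomm b A X A'.
Proof. by move=> -> ->. Qed.

Lemma scommM b b' m n (A B : 'M_m) (X : 'M_(m, n)) (A' B' : 'M_n) :
  scomm b A X A' -> scomm b' B X B' -> scomm (b (+) b') (A *m B) X (A' *m B').
Proof.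
rewrite /scomm => hA hB; rewrite -[LHS]mulmxA hB -scalemxAr [A *m _]mulmxA hA.
by rewrite -scalemxAl scalerA -signr_addb addbC mulmxA.
Qed.

Lemma scomm_trans b b' m n k (A : 'M_m) (X : 'M_(m, n)) (A' : 'M_n)
    (Y : 'M_(n, k)) (A'' : 'M_k) :
  scomm b A X A' -> scomm b' A' Y A'' -> scomm (b (+) b') A (X *m Y) A''.
Proof.
rewrite /scomm => hX hY; rewrite [LHS]mulmxA hX -scalemxAl -[X *m A' *m Y]mulmxA.
by rewrite hY -scalemxAr scalerA -signr_addb mulmxA.
Qed.

Lemma scommN b m n (A : 'M_m) (X : 'M_(m, n)) (A' : 'M_n) :
  scomm b A X A' -> scomm b (- A) X (- A').
Proof. by rewrite /scomm => hA; rewrite mulNmx hA mulmxN scalerN. Qed.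

Lemma scommZ b c m n z (A : 'M_m) (X : 'M_(m, n)) (A' : 'M_n) :
  scomm b A X A' -> scomm (b (+) c) (((-1) ^+ c * z) *: A) X (z *: A').
Proof.
rewrite /scomm => hA; rewrite -scalemxAl hA -scalemxAr !scalerA.
by congr (_ *: _); rewrite signr_addb [LHS]mulrC mulrA.
Qed.

Lemma scommZ0 b m n z (A : 'M_m) (X : 'M_(m, n)) (A' : 'M_n) :
  scomm b A X A' -> scomm b (z *: A) X (z *: A').
Proof. by move=> /(scommZ false z); rewrite addbF expr0 mul1r. Qed.

Lemma scomm0 m n (A : 'M_m) (X : 'M_(m, n)) (A' : 'M_n) :
  scomm false A X A' <-> A *m X = X *m A'.
Proof. by rewrite /scomm expr0 scale1r. Qed.

Lemma scomm1 m n (A : 'M_m) (X : 'M_(m, n)) (A' : 'M_n) :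
  scomm true A X A' <-> A *m X = - (X *m A').
Proof. by rewrite /scomm expr1 scaleN1r. Qed.

Lemma scomm_cornerP b c b' c' m n (S A : 'M_m) (X : 'M_(m, n)) (S' A' : 'M_n) :
  scomm b S X S' -> scomm c A X A' ->
  cornerP S A b' c' *m X = X *m cornerP S' A' (b' (+) b) (c' (+) c).
Proof.
move=> hS hA; rewrite /cornerP -[LHS]mulmxA (halfproj_comm c' hA).
by rewrite [LHS]mulmxA (halfproj_comm b' hS) mulmxA.
Qed.

Lemma map_cornerP (f : {rmorphism K -> K}) b c n (S A : 'M_n) :
  map_mx f (cornerP S A b c) = cornerP (map_mx f S) (map_mx f A) b c.
Proof. by rewrite /cornerP map_mxM !map_halfproj. Qed.

Section FourOperators.
Variables (m n : nat) (F : nat -> 'M[K]_m) (E : nat -> 'M[K]_n).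
Variables (X : 'M[K]_(m, n)) (b : bool).
Hypothesis FX : forall k, (k < 4)%N -> scomm b (F k) X (E k).

Lemma scomm_opI : scomm false (opI F) X (opI E).
Proof. by rewrite -(addbb b); apply: scommM; exact: FX. Qed.

Lemma scomm_opJ : scomm false (opJ F) X (opJ E).
Proof. by rewrite -(addbb b); apply: scommM; exact: FX. Qed.

Lemma scomm_opEps : scomm b (opEps F) X (opEps E).
Proof. by apply: scommN; rewrite -(addbF b); exact: scommM (FX _) scomm_opJ. Qed.

Lemma scomm_opA : scomm false (opA F) X (opA E).
Proof.
have -> : false = b (+) (b (+) (b (+) b)) by rewrite addbb addbF addbb.
by do 3 (apply: scommM; first exact: FX); exact: FX.
Qed.

End FourOperators.

Lemma map_opI (f : {rmorphism K -> K}) n (E : nat -> 'M[K]_n) :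
  map_mx f (opI E) = opI (fun k => map_mx f (E k)).
Proof. by rewrite /opI map_mxM. Qed.
Lemma map_opJ (f : {rmorphism K -> K}) n (E : nat -> 'M[K]_n) :
  map_mx f (opJ E) = opJ (fun k => map_mx f (E k)).
Proof. by rewrite /opJ map_mxM. Qed.
Lemma map_opEps (f : {rmorphism K -> K}) n (E : nat -> 'M[K]_n) :
  map_mx f (opEps E) = opEps (fun k => map_mx f (E k)).
Proof. by rewrite /opEps map_mxN !map_mxM. Qed.
Lemma map_opA (f : {rmorphism K -> K}) n (E : nat -> 'M[K]_n) :
  map_mx f (opA E) = opA (fun k => map_mx f (E k)).
Proof. by rewrite /opA !map_mxM. Qed.

(** The sign [c] records whether the conjugation changes the imaginary unit in
    the definition of [opS]. *)
Lemma scomm_map_opS (f : {rmorphism K -> K}) (c : bool) m n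
    (F : nat -> 'M[K]_m) (E : nat -> 'M[K]_n) (X : 'M_(m, n)) b :
    f 'i = (-1) ^+ c * 'i ->
    (forall k, (k < 4)%N -> scomm b (map_mx f (F k)) X (E k)) ->
  scomm c (map_mx f (opS F)) X (opS E).
Proof.
move=> fi FX; rewrite /opS map_mxZ rmorphN fi -mulrN -[c in scomm c]addFb.
by apply: scommZ; rewrite map_opI; exact: scomm_opI FX.
Qed.

(** In [C *m B *m C *m B = C *m B], with [C] the column base and [B] the row
    base, [C] cancels on the left and [B] on the right. *)
Lemma row_col_base (F : fieldType) n (e : 'M[F]_n) : e *m e = e ->
  row_base e *m col_base e = 1%:M.
Proof.
have := mulmx_base e; have [X XC] := row_fullP (col_base_full e).
have [Y BY] := row_freeP (row_base_free e).
move: (\rank e) (row_base e) (col_base e) X XC Y BY => r B C X XC Y BY CB ee.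
have : X *m (e *m e) *m Y = X *m e *m Y by rewrite ee.
by rewrite -CB !mulmxA XC !mul1mx -!mulmxA BY !mulmx1.
Qed.

End SignCommutation.

(** Maps that commute with the corner idempotent [e] can be composed after
    restriction to its image, since [e] is absorbed by [C']. *)
Lemma corner_cancel (K : pzRingType) m n r n' r' (W : 'M[K]_(m, n))
    (C : 'M_(n, r)) (B : 'M_(r, n)) (e : 'M_n) (Y : 'M_(n, n')) (e' : 'M_n')
    (C' : 'M_(n', r')) :
    C *m B = e -> e *m Y = Y *m e' -> e' *m C' = C' ->
  W *m C *m (B *m Y *m C') = W *m Y *m C'.
Proof.
move=> CB eY eC; rewrite !mulmxA -(mulmxA W C B) CB -(mulmxA W e Y) eY.
by rewrite mulmxA -(mulmxA _ e' C') eC.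
Qed.

Section Restriction.
Context (R : realType) (G : magneticGroup) (p q : nat) (lam : G -> R[i]).
Hypothesis lamP : is_trivialisation lam.

Section OneRep.
Variables (n : nat) (O : ops R G (p + (q + 4)) n).

Definition newop (k : nat) : 'M[R[i]]_n := o_gen O (new_gen p q (inord k)).
Definition ocorner : 'M[R[i]]_n := corner (opS newop) (opA newop).
Definition jpow (b : bool) : 'M[R[i]]_n := if b then - opJ newop else 1%:M.

(** The operators on the image of the corner, for a splitting [C *m B] of it.
    The factor [jpow (phib g)] brings the image under an antilinear [g] back to
    the corner. *)
Definition compress r (B : 'M[R[i]]_(r, n)) (C : 'M[R[i]]_(n, r)) :
    ops R G (p + q) r :=
  Ops (fun j => B *m o_gen O (old_gen j) *m C)
      (fun g => (lam g)^-1 *: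
        (Kmx (mg_phi g) B *m (o_act O g *m jpow (phib g)) *m C))
      (B *m o_par O *m C).

Hypothesis repO : is_rep O.

Lemma newop_sq k : newop k *m newop k = - 1%:M.
Proof. by rewrite (rep_sq repO) new_gen_ge raddfN. Qed.

Lemma newop_anti k l : (k < 4)%N -> (l < 4)%N -> k != l ->
  newop k *m newop l = - (newop l *m newop k).
Proof.
move=> k4 l4 kl; apply: (rep_anti repO).
by rewrite (inj_eq (@new_gen_inj _ _)) -val_eqE /= !inordK.
Qed.

Lemma newop_frame :
  is_frame (opS newop) (opA newop) (opJ newop) (opEps newop).
Proof. exact: four_frame newop_sq newop_anti. Qed.

Lemma ocorner_idem : ocorner *m ocorner = ocorner.
Proof.
by rewrite /ocorner /corner (cornerPM newop_frame) !eqxx scale1r.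
Qed.

Lemma old_scomm j k : scomm true (newop k) (o_gen O (old_gen j)) (newop k).
Proof.
by apply/scomm1; apply: (rep_anti repO); rewrite eq_sym old_new_gen.
Qed.

Lemma par_scomm k : scomm true (newop k) (o_par O) (newop k).
Proof. by apply/scomm1; exact: (rep_gen_par repO). Qed.

Lemma act_scomm g k :
  scomm false (Kmx (mg_phi g) (newop k)) (o_act O g) (newop k).
Proof. by apply/scomm0; exact: (rep_act_gen repO). Qed.

Lemma jpow_act g b :
  Kmx (mg_phi g) (jpow b) *m o_act O g = o_act O g *m jpow b.
Proof.
rewrite /jpow; case: b; last by rewrite map_mx1 mulmx1 mul1mx.
apply/scomm0; rewrite map_mxN; apply: scommN; rewrite map_opJ.
by apply: (scomm_opJ (b := false)) => k _; exact: act_scomm.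
Qed.

Lemma jpowM b b' :
  jpow b *m jpow b' = (-1) ^+ (b && b') *: jpow (b (+) b').
Proof.
rewrite /jpow; case: b b' => [] []; rewrite /= ?expr0 ?expr1 ?scale1r;
  rewrite ?mulmx1 ?mul1mx // mulmxN mulNmx opprK (frame_J2 newop_frame).
by rewrite scaleN1r.
Qed.

Section Anticommuting.
Variable X : 'M[R[i]]_n.
Hypothesis hX : forall k, scomm true (newop k) X (newop k).

Lemma ocorner_anti : ocorner *m X = X *m ocorner.
Proof.
apply: (@scomm_cornerP _ false false).
  by apply: scommZ0; apply: (scomm_opI (b := true)) => k _; exact: hX.
by apply: (scomm_opA (b := true)) => k _; exact: hX.
Qed.

Lemma jpow_anti b : jpow b *m X = X *m jpow b.
Proof.
rewrite /jpow; case: b; last by rewrite mulmx1 mul1mx.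
by apply/scomm0; apply: scommN; apply: (scomm_opJ (b := true)).
Qed.

End Anticommuting.

(** Conjugation by an antilinear [g] and the factor [- J] both reverse the sign of
    [opS], so that together they preserve the corner. *)
Lemma ocorner_act g :
  Kmx (mg_phi g) ocorner *m (o_act O g *m jpow (phib g)) =
  o_act O g *m jpow (phib g) *m ocorner.
Proof.
have SJ b : scomm b (opS newop) (jpow b) (opS newop).
  rewrite /jpow; case: b; last by apply/scomm0; rewrite mulmx1 mul1mx.
  by apply/scomm1; rewrite mulmxN mulNmx (frame_SJ newop_frame).
have AJ b : scomm false (opA newop) (jpow b) (opA newop).
  apply/scomm0; rewrite /jpow; case: b; last by rewrite mulmx1 mul1mx.
  by rewrite mulmxN mulNmx (frame_AJ newop_frame).
rewrite map_cornerP.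
rewrite (@scomm_cornerP _ (phib g (+) phib g) (false (+) false) _ _ _ _ _ _ _
  (opS newop) (opA newop)).
- by rewrite addbb.
- apply: scomm_trans (SJ _).
  apply: (scomm_map_opS (b := false)); first exact: Kpow_sign_i.
  by move=> k _; exact: act_scomm.
- apply: scomm_trans (AJ _); rewrite map_opA.
  by apply: (scomm_opA (b := false)) => k _; exact: act_scomm.
Qed.

Section Compression.
Variables (r : nat) (B : 'M[R[i]]_(r, n)) (C : 'M[R[i]]_(n, r)).
Hypotheses (CB : C *m B = ocorner) (BC : B *m C = 1%:M).

Let eC : ocorner *m C = C. Proof. exact: corner_mul CB BC. Qed.

(** The sign from [jpowM] in the product of two antilinear elements is cancelled
    by [lam]. *)
Lemma compress_rep : is_rep (compress B C).
Proof.
have ocM m (W : 'M_(m, n)) (X : 'M_n) : (forall k, scomm true (newop k) X (newop k)) ->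
    W *m C *m (B *m X *m C) = W *m X *m C.
  move=> hX; apply: corner_cancel CB _ eC; exact: ocorner_anti.
have KCB (g : G) : Kmx (mg_phi g) C *m Kmx (mg_phi g) B = Kmx (mg_phi g) ocorner.
  by rewrite -map_mxM CB.
split=> /=.
- move=> j; rewrite ocM; last exact: old_scomm.
  rewrite -(mulmxA B) (rep_sq repO) scalar_mxC -mulmxA BC mulmx1.
  by rewrite val_old_gen.
- move=> j k jk; rewrite !ocM; try exact: old_scomm.
  have ojk : old_gen j != old_gen k by rewrite (inj_eq (@old_gen_inj _ _)).
  rewrite -!(mulmxA B) [X in B *m (X *m _)](rep_anti repO ojk).
  by rewrite mulNmx mulmxN.
- rewrite ocM; last exact: par_scomm.
  by rewrite -!(mulmxA B) (rep_par2 repO) mul1mx BC.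
- move=> j; rewrite ocM; last exact: par_scomm.
  rewrite ocM; last exact: old_scomm.
  by rewrite -!(mulmxA B) (rep_gen_par repO) mulNmx mulmxN.
- rewrite (triv1 lamP) phib1 (rep_act1 repO) mg_phi1 Kmx0 /jpow mulmx1 mulmx1.
  by rewrite BC invr1 scale1r.
- move=> g h; rewrite [in RHS]map_mxZ !map_mxM -scalemxAl -scalemxAr scalerA.
  rewrite (corner_cancel _ (KCB g) (ocorner_act g) eC).
  rewrite mg_phiM KmxD (rep_actM repO) phibM.
  (* The first J moves past the second group element to meet the other J. *)
  have -> : Kmx (mg_phi g) (Kmx (mg_phi h) B) *m
      (Kmx (mg_phi g) (o_act O h) *m Kmx (mg_phi g) (jpow (phib h))) *m
      (o_act O g *m jpow (phib g)) = (-1) ^+ (phib g && phib h) *: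
      (Kmx (mg_phi g) (Kmx (mg_phi h) B) *m
       (Kmx (mg_phi g) (o_act O h) *m o_act O g *m jpow (phib g (+) phib h))).
    rewrite -!mulmxA (mulmxA _ (o_act O g)) jpow_act -(mulmxA (o_act O g)) jpowM.
    by rewrite andbC addbC -!scalemxAr.
  rewrite -scalemxAl scalerA; congr (_ *: _).
  have [lam0 lamM] := lamP.
  apply: (mulIf (lam0 (g * h)%g)); rewrite mulVf //.
  rewrite fmorphV -invfM -mulrA lamM.
  by rewrite [_ * Kpow _ _]mulrC mulVf // mulf_neq0 // fmorph_eq0.
- move=> g j; rewrite !map_mxM -scalemxAr -[in RHS]scalemxAl; congr (_ *: _).
  rewrite (corner_cancel _ (KCB g) (ocorner_act g) eC).
  rewrite ocM; last exact: old_scomm.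
  rewrite -!mulmxA (mulmxA (Kmx _ (o_gen O _))) (rep_act_gen repO) -!mulmxA.
  by rewrite (mulmxA (jpow _)) (jpow_anti (old_scomm j)) -mulmxA.
- move=> g; rewrite !map_mxM -scalemxAr -[in RHS]scalemxAl; congr (_ *: _).
  rewrite (corner_cancel _ (KCB g) (ocorner_act g) eC).
  rewrite ocM; last exact: par_scomm.
  rewrite -!mulmxA (mulmxA (Kmx _ (o_par O))) (rep_act_par repO) -!mulmxA.
  by rewrite (mulmxA (jpow _)) (jpow_anti par_scomm) -mulmxA.
Qed.

End Compression.

End OneRep.
End Restriction.

Lemma map_spread (K : numClosedFieldType) (f : {rmorphism K -> K}) n r
    (J Eps : 'M[K]_n) (C : 'M_(n, r)) :
  map_mx f (spread J Eps C) =
  spread (map_mx f J) (map_mx f Eps) (map_mx f C).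
Proof. by rewrite /spread !map_row_mx !map_mxN !map_mxM. Qed.

(** * The two constructions are inverse *)

Section Spread.
Context (K : numClosedFieldType) (n n' r r' : nat).
Variables (J Eps : 'M[K]_n) (C : 'M[K]_(n, r)).
Variables (J' Eps' : 'M[K]_n') (C' : 'M[K]_(n', r')).
Variables (X : 'M[K]_(n, n')) (Y : 'M[K]_(r, r')).

Lemma spread_linear (b : bool) :
    J *m X = X *m J' -> Eps *m X = (-1) ^+ b *: (X *m Eps') ->
    X *m C' = C *m Y ->
  X *m spread J' Eps' C' = spread J Eps C *m pauli2 false false false b Y.
Proof.
move=> hJ hEps hC; rewrite /spread mul_row_pauli2 expr0 scale1r !mul_row_pauli.
have hEps' : X *m (Eps' *m C') = (-1) ^+ b *: (Eps *m C *m Y).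
  rewrite mulmxA -[Eps *m C *m Y]mulmxA -hC [Eps *m (X *m C')]mulmxA hEps.
  by rewrite -scalemxAl scalerA -expr2 sqrr_sign scale1r.
have hJ' m (Z : 'M_(n', m)) : X *m (J' *m Z) = J *m (X *m Z).
  by rewrite !mulmxA hJ.
rewrite !mul_mx_row !mulmxN !hJ' hEps' hC !mulNmx !mulmxA.
by rewrite -scalemxAr scalerN !mulmxA.
Qed.

(** For an antilinear element the map [Y] between the corners contains the
    inverse of J, and J exchanges the outer copies. *)
Lemma spread_antilinear :
    J *m X = X *m J' -> Eps *m X = X *m Eps' ->
    J' *m J' = - 1%:M -> J' *m Eps' = Eps' *m J' ->
    X *m (J' *m C') = - (C *m Y) ->
  X *m spread J' Eps' C' = spread J Eps C *m pauli2 true true false false Y.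
Proof.
move=> hJ hEps J'2 JE' hC.
have {}hC : C *m Y = - (X *m (J' *m C')) by rewrite hC opprK.
have hJ' m (Z : 'M_(n', m)) : J *m (X *m Z) = X *m (J' *m Z).
  by rewrite !mulmxA hJ.
have hEps' m (Z : 'M_(n', m)) : Eps *m (X *m Z) = X *m (Eps' *m Z).
  by rewrite !mulmxA hEps.
have JJ m (Z : 'M_(n', m)) : J' *m (J' *m Z) = - Z.
  by rewrite mulmxA J'2 mulNmx mul1mx.
have EJ m (Z : 'M_(n', m)) : Eps' *m (J' *m Z) = J' *m (Eps' *m Z).
  by rewrite !mulmxA JE'.
rewrite /spread mul_row_pauli2 !mul_row_pauli !expr0 expr1 !scale1r scaleN1r.
rewrite !opp_row_mx !mulNmx !opprK -!mulmxA hC !mulmxN hEps' EJ !hJ' !JJ.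
by rewrite !mulmxN !opprK !mul_mx_row !mulmxN.
Qed.

End Spread.

Section SpreadFrame.
Context (K : numClosedFieldType) (n r : nat) (S A J Eps : 'M[K]_n).
Hypothesis frame : is_frame S A J Eps.
Variable C : 'M[K]_(n, r).
Hypothesis eC : corner S A *m C = C.

Lemma frame_SC : S *m C = C.
Proof.
rewrite -eC /corner /cornerP !mulmxA (mul_sign_halfproj false (frame_S2 frame)).
by rewrite expr0 scale1r.
Qed.

Lemma frame_AC : A *m C = C.
Proof.
have SA : S *m A = (-1) ^+ false *: (A *m S).
  by rewrite expr0 scale1r (frame_SA frame).
rewrite -eC /corner /cornerP !mulmxA -(addbF false) -(halfproj_comm false SA).
rewrite addbF -!mulmxA (mulmxA A) (mul_sign_halfproj false (frame_A2 frame)).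
by rewrite expr0 scale1r.
Qed.

Lemma spread_A : A *m spread J Eps C =
  spread J Eps C *m pauli2 false false false true 1%:M.
Proof.
apply: spread_linear; first by rewrite (frame_AJ frame).
  by rewrite expr1 scaleN1r (frame_AEps frame) opprK.
by rewrite mulmx1 frame_AC.
Qed.

Lemma spread_S : S *m spread J Eps C =
  spread J Eps C *m pauli2 false true false false 1%:M.
Proof.
have SJ m (Z : 'M_(n, m)) : S *m (J *m Z) = - (J *m (S *m Z)).
  by rewrite !mulmxA (frame_SJ frame) mulNmx.
have SE m (Z : 'M_(n, m)) : S *m (Eps *m Z) = Eps *m (S *m Z).
  by rewrite !mulmxA (frame_SEps frame).
rewrite /spread mul_row_pauli2 !mul_row_pauli expr0 expr1 !scale1r !mulmx1.
by rewrite !mul_mx_row !mulmxN !SJ !SE frame_SC scaleN1r opp_row_mx.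
Qed.

Lemma spread_Eps : Eps *m spread J Eps C =
  spread J Eps C *m pauli2 false false true false 1%:M.
Proof.
have EE m (Z : 'M_(n, m)) : Eps *m (Eps *m Z) = Z.
  by rewrite mulmxA (frame_Eps2 frame) mul1mx.
have EJ m (Z : 'M_(n, m)) : Eps *m (J *m Z) = J *m (Eps *m Z).
  by rewrite !mulmxA (frame_JEps frame).
rewrite /spread mul_row_pauli2 !mul_row_pauli !expr0 !scale1r !mulmx1.
by rewrite !mul_mx_row !mulmxN !EJ !EE.
Qed.

Lemma spread_J : J *m spread J Eps C =
  spread J Eps C *m pauli2 true true false false 1%:M.
Proof.
have JJ m (Z : 'M_(n, m)) : J *m (J *m Z) = - Z.
  by rewrite mulmxA (frame_J2 frame) mulNmx mul1mx.
rewrite /spread mul_row_pauli2 !mul_row_pauli !expr0 expr1 !scale1r !mulmx1.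
by rewrite !mul_mx_row !mulmxN !JJ scaleN1r opp_row_mx !opprK.
Qed.

End SpreadFrame.

Section CompressionOfMaps.
Context (R : realType) (G : magneticGroup) (p q : nat) (lam : G -> R[i]).
Variables (n n' r r' : nat).
Variables (O : ops R G (p + (q + 4)) n) (O' : ops R G (p + (q + 4)) n').
Variables (B : 'M[R[i]]_(r, n)) (C : 'M[R[i]]_(n, r)).
Variables (B' : 'M[R[i]]_(r', n')) (C' : 'M[R[i]]_(n', r')).
Hypotheses (repO : is_rep O) (repO' : is_rep O').
Hypotheses (CB : C *m B = ocorner O) (BC : B *m C = 1%:M).
Hypotheses (CB' : C' *m B' = ocorner O') (BC' : B' *m C' = 1%:M).

Let eC : ocorner O *m C = C. Proof. exact: corner_mul CB BC. Qed.
Let eC' : ocorner O' *m C' = C'. Proof. exact: corner_mul CB' BC'. Qed.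

Section OneMap.
Variable S : 'M[R[i]]_(n, n').
Hypothesis hS : intertwines O O' S.

Let newop_S k : scomm false (newop O k) S (newop O' k).
Proof. by apply/scomm0; exact: hS.1. Qed.

Lemma ocorner_intertwined : ocorner O *m S = S *m ocorner O'.
Proof.
apply: (@scomm_cornerP _ false false).
  by apply: scommZ0; apply: (scomm_opI (b := false)) => k _; exact: newop_S.
by apply: (scomm_opA (b := false)) => k _; exact: newop_S.
Qed.

Lemma opJ_intertwined : opJ (newop O) *m S = S *m opJ (newop O').
Proof.
by apply/scomm0; apply: (scomm_opJ (b := false)) => k _; exact: newop_S.
Qed.

Lemma opEps_intertwined : opEps (newop O) *m S = S *m opEps (newop O').
Proof.
by apply/scomm0; apply: (scomm_opEps (b := false)) => k _; exact: newop_S.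
Qed.

Lemma jpow_intertwined b : jpow O b *m S = S *m jpow O' b.
Proof.
rewrite /jpow; case: b; last by rewrite mulmx1 mul1mx.
by rewrite mulNmx mulmxN opJ_intertwined.
Qed.

Lemma compress_mx_intertwines :
  intertwines (compress lam O B C) (compress lam O' B' C') (B *m S *m C').
Proof.
have [hgen hact] := hS.
have ocS m (W : 'M_(m, n)) : W *m C *m (B *m S *m C') = W *m S *m C'.
  by apply: corner_cancel CB _ eC'; exact: ocorner_intertwined.
have ocX m (W : 'M_(m, n')) (X : 'M_n') :
    (forall k, scomm true (newop O' k) X (newop O' k)) ->
    W *m C' *m (B' *m X *m C') = W *m X *m C'.
  by move=> hX; apply: corner_cancel CB' _ eC'; exact: ocorner_anti.
split=> [j|g] /=.
  rewrite ocS ocX; last exact: old_scomm.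
  by rewrite -!(mulmxA B) hgen.
rewrite -scalemxAl -scalemxAr; congr (_ *: _).
have KCB : Kmx (mg_phi g) C' *m Kmx (mg_phi g) B' = Kmx (mg_phi g) (ocorner O').
  by rewrite -map_mxM CB'.
rewrite ocS [in RHS]map_mxM [in RHS]map_mxM.
rewrite (corner_cancel _ KCB (ocorner_act repO' g) eC').
rewrite -!mulmxA (mulmxA (jpow O _)) jpow_intertwined -!mulmxA.
by rewrite (mulmxA (o_act O g)) hact -!mulmxA.
Qed.

Lemma compress_mx_even : even_mx O O' S ->
  even_mx (compress lam O B C) (compress lam O' B' C') (B *m S *m C').
Proof.
move=> hpar; rewrite /even_mx /=.
rewrite (corner_cancel _ CB ocorner_intertwined eC').
rewrite (corner_cancel _ CB' (ocorner_anti (par_scomm repO')) eC').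
by rewrite -!(mulmxA B) hpar.
Qed.

End OneMap.

End CompressionOfMaps.

Section ExtendedOperators.
Context (R : realType) (G : magneticGroup) (p q : nat) (lam : G -> R[i]).
Variables (n : nat) (O : ops R G (p + q) n).
Local Notation D := (ext_ops lam O).
Local Notation one := (1%:M : 'M[R[i]]_n).

Lemma newop_ext k : newop D k = new_mx R n (inord k).
Proof. exact: ext_ops_new. Qed.

Let ii : 'i * 'i = -1 :> R[i]. Proof. by rewrite -expr2 sqrCi. Qed.

Lemma opI_ext : opI (newop D) = 'i *: pauli2 false true false false one.
Proof.
rewrite /opI !newop_ext /new_mx /new_bits /new_coef !inordK //=.
rewrite -scalemxAl -scalemxAr pauli2M mulmx1 /= !scalerA.
by rewrite expr0 mul1r mulr1.
Qed.

Lemma opJ_ext : opJ (newop D) = pauli2 true true false false one.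
Proof.
rewrite /opJ !newop_ext /new_mx /new_bits /new_coef !inordK //=.
rewrite -scalemxAl -scalemxAr pauli2M mulmx1 /= !scalerA ii.
by rewrite expr1 mulrNN mulr1 scale1r.
Qed.

Lemma opS_ext : opS (newop D) = pauli2 false true false false one.
Proof. by rewrite /opS opI_ext scalerA mulNr ii opprK scale1r. Qed.

Lemma opEps_ext : opEps (newop D) = pauli2 false false true false one.
Proof.
rewrite /opEps mulmxA -/(opI _) opI_ext.
rewrite !newop_ext /new_mx /new_bits /new_coef !inordK //=.
rewrite -scalemxAl -scalemxAr pauli2M mulmx1 /= !scalerA ii.
by rewrite expr0 mulr1 scaleN1r opprK.
Qed.

Lemma opA_ext : opA (newop D) = pauli2 false false false true one.
Proof.
have -> : opA (newop D) = - (opEps (newop D) *m newop D 3).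
  by rewrite /opEps mulNmx opprK /opA !mulmxA.
rewrite opEps_ext newop_ext /new_mx /new_bits /new_coef !inordK //=.
rewrite -scalemxAr pauli2M mulmx1 /= !scalerA.
by rewrite expr1 mul1r scaleN1r opprK.
Qed.

Definition first_block : 'M[R[i]]_(n, (n + n) + (n + n)) :=
  row_mx (row_mx 1%:M 0) 0.
Definition first_coblock : 'M[R[i]]_((n + n) + (n + n), n) :=
  col_mx (col_mx 1%:M 0) 0.

Lemma first_blockK : first_block *m first_coblock = 1%:M.
Proof. by rewrite !mul_row_col !mulmx0 mulmx1 !addr0. Qed.

Lemma halfproj_pauli (K : numFieldType) m :
  halfproj false (pauli false true (1%:M : 'M[K]_m)) = block_mx 1%:M 0 0 0.
Proof.
rewrite /halfproj /pauli expr0 expr1 scale1r scaleN1r scalar_mx_block.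
rewrite add_block_mx !addr0 subrr scale_block_mx !scaler0.
by rewrite scale_half.
Qed.

(** The two half projections select the first outer and the first inner copy. *)
Lemma ocorner_ext : ocorner D = first_coblock *m first_block.
Proof.
have hS : halfproj false (opS (newop D)) = block_mx 1%:M 0 0 0.
  by rewrite opS_ext /pauli2 pauli_scalar halfproj_pauli.
have hA : halfproj false (opA (newop D)) =
    pauli false false (block_mx 1%:M 0 0 0).
  rewrite opA_ext /pauli2 -halfproj_pauli /halfproj.
  by rewrite !pauliZ pauliD pauli_scalar pauliZ.
apply: etrans (congr2 mulmx hS hA) _.
rewrite /pauli expr0 scale1r mulmx_block /first_coblock /first_block.
rewrite !mul_col_row !mulmx0 !mul0mx !addr0 !mulmx1.
by rewrite mul1mx.
Qed.

Lemma first_block_corner : first_block *m ocorner D = first_block.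
Proof. by rewrite ocorner_ext mulmxA first_blockK mul1mx. Qed.

Lemma map_first_block (f : {rmorphism R[i] -> R[i]}) :
  map_mx f first_block = first_block.
Proof. by rewrite !map_row_mx map_mx1 !map_mx0. Qed.

End ExtendedOperators.

Lemma first_block_mul (R : realType) n n' c e (X : 'M[R[i]]_(n, n')) :
  first_block R n *m pauli2 false c false e X = X *m first_block R n'.
Proof.
rewrite /first_block /pauli2 mul_row_pauli mul0mx scaler0 mul_row_pauli.
by rewrite mul0mx scaler0 mul1mx !mul_mx_row mulmx1 !mulmx0.
Qed.

Section RestrictExtension.
Context (R : realType) (G : magneticGroup) (p q : nat) (lam : G -> R[i]).
Hypothesis lamP : is_trivialisation lam.
Variables (n : nat) (O : ops R G (p + q) n).
Variable D : ops R G (p + (q + 4)) ((n + n) + (n + n)).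
Hypotheses (repO : is_rep O) (defD : D = ext_ops lam O).
Variables (r : nat) (B : 'M[R[i]]_(r, (n + n) + (n + n))).
Variable C : 'M[R[i]]_((n + n) + (n + n), r).
Hypotheses (CB : C *m B = ocorner D) (BC : B *m C = 1%:M).

Let repD : is_rep D. Proof. by rewrite defD; exact: ext_ops_rep. Qed.
Let eC : ocorner D *m C = C. Proof. exact: corner_mul CB BC. Qed.

Lemma restr_ext_intertwines :
  intertwines O (compress lam D B C) (first_block R n *m C).
Proof.
have [lam0 _] := lamP.
split=> [j|g] /=.
  rewrite (corner_cancel _ CB (ocorner_anti (old_scomm repD j)) eC).
  by rewrite defD ext_ops_old first_block_mul mulmxA.
rewrite map_mxM map_first_block -scalemxAr.
have KCB : Kmx (mg_phi g) C *m Kmx (mg_phi g) B = Kmx (mg_phi g) (ocorner D).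
  by rewrite -map_mxM CB.
rewrite (corner_cancel _ KCB (ocorner_act repD g) eC).
(* The exchange of the outer copies by g is undone by the inverse of J. *)
have -> : o_act D g *m jpow D (phib g) =
    lam g *: pauli2 false false false false (o_act O g).
  rewrite /jpow defD opJ_ext /= -scalemxAl; congr (_ *: _).
  case: (phib g); last by rewrite mulmx1.
  by rewrite mulmxN pauli2M mulmx1 /= expr1 scaleN1r opprK.
rewrite -scalemxAr -scalemxAl scalerA mulVf // scale1r first_block_mul.
by rewrite mulmxA.
Qed.

Lemma restr_ext_even : even_mx O (compress lam D B C) (first_block R n *m C).
Proof.
rewrite /even_mx /= (corner_cancel _ CB (ocorner_anti (par_scomm repD)) eC).
by rewrite defD /= first_block_mul mulmxA.
Qed.

Lemma first_block_out_in : first_block R n *m C *m (B *m first_coblock R n) = 1%:M.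
Proof.
rewrite mulmxA -(mulmxA _ C) CB defD first_block_corner.
exact: first_blockK.
Qed.

Lemma first_block_in_out : B *m first_coblock R n *m (first_block R n *m C) = 1%:M.
Proof.
rewrite mulmxA -(mulmxA B) -(ocorner_ext lam O) -defD -CB mulmxA BC mul1mx.
exact: BC.
Qed.

Lemma restr_ext_natural n' (O' : ops R G (p + q) n') (S : 'M_(n, n'))
    (D' : ops R G (p + (q + 4)) ((n' + n') + (n' + n'))) r'
    (B' : 'M[R[i]]_(r', (n' + n') + (n' + n'))) C' :
    intertwines O O' S -> D' = ext_ops lam O' ->
    C' *m B' = ocorner D' -> B' *m C' = 1%:M ->
  S *m (first_block R n' *m C') =
  first_block R n *m C *m (B *m ext_mx S *m C').
Proof.
move=> hS defD' CB' BC'.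
have eC' : ocorner D' *m C' = C' by exact: corner_mul CB' BC'.
have extS : intertwines D D' (ext_mx S).
  by rewrite defD defD'; exact: ext_mx_intertwines.
rewrite (corner_cancel _ CB (ocorner_intertwined extS) eC').
by rewrite /ext_mx first_block_mul mulmxA.
Qed.

End RestrictExtension.

Section ExtendRestriction.
Context (R : realType) (G : magneticGroup) (p q : nat) (lam : G -> R[i]).
Hypothesis lamP : is_trivialisation lam.
Variables (n : nat) (O : ops R G (p + (q + 4)) n).
Hypothesis repO : is_rep O.
Variables (r : nat) (B : 'M[R[i]]_(r, n)) (C : 'M[R[i]]_(n, r)).
Hypotheses (CB : C *m B = ocorner O) (BC : B *m C = 1%:M).

Let frame := newop_frame repO.
Let eC : ocorner O *m C = C. Proof. exact: corner_mul CB BC. Qed.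
Local Notation D := (ext_ops lam (compress lam O B C)).
Local Notation Xi := (spread (opJ (newop O)) (opEps (newop O)) C).

Let repD : is_rep D.
Proof. by apply: ext_ops_rep => //; exact: compress_rep. Qed.

Let Xi_anti (X : 'M[R[i]]_n) :
    (forall k, scomm true (newop O k) X (newop O k)) ->
  X *m Xi = Xi *m pauli2 false false false true (B *m X *m C).
Proof.
move=> hX; apply: spread_linear.
- by apply/scomm0; apply: (scomm_opJ (b := true)) => k _; exact: hX.
- by apply: (scomm_opEps (b := true)) => k _; exact: hX.
- by rewrite !mulmxA CB (ocorner_anti hX) -mulmxA eC.
Qed.

Let Xi_J : scomm false (opJ (newop O)) Xi (opJ (newop D)).
Proof. by apply/scomm0; rewrite opJ_ext; exact: (spread_J frame C). Qed.

Let Xi_Eps : scomm false (opEps (newop O)) Xi (opEps (newop D)).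
Proof. by apply/scomm0; rewrite opEps_ext; exact: (spread_Eps frame C). Qed.

Let Xi_A : scomm false (opA (newop O)) Xi (opA (newop D)).
Proof. by apply/scomm0; rewrite opA_ext; exact: (spread_A frame eC). Qed.

Let Xi_I : scomm false (opI (newop O)) Xi (opI (newop D)).
Proof.
rewrite !opIS; apply: scommZ0; apply/scomm0; rewrite opS_ext.
exact: (spread_S frame eC).
Qed.

(** The new generators are products of I, J, Eps and A, for which the statement
    is read off from the definition of [spread]. *)
Let Xi_new k : scomm false (o_gen O (new_gen p q k)) Xi
  (o_gen D (new_gen p q k)).
Proof.
suff: forall l, (l < 4)%N -> scomm false (newop O l) Xi (newop D l).
  by move=> /(_ k (ltn_ord k)); rewrite /newop inord_val.
have sqO := newop_sq repO; have sqD := newop_sq repD.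
have antiO := newop_anti repO; have antiD := newop_anti repD.
case=> [|[|[|[|l]]]] lt4; last by exfalso.
- apply: (eq_scomm (E0E sqO antiO) (E0E sqD antiD)).
  exact: (scommM Xi_Eps Xi_J).
- apply: (eq_scomm (E1E sqO antiO) (E1E sqD antiD)); apply: scommN.
  exact: (scommM (scommM Xi_Eps Xi_J) Xi_I).
- apply: (eq_scomm (E2E sqO antiO) (E2E sqD antiD)).
  exact: (scommM Xi_I Xi_Eps).
- apply: (eq_scomm (E3E sqO antiO) (E3E sqD antiD)); apply: scommN.
  exact: (scommM Xi_Eps Xi_A).
Qed.

Lemma spread_intertwines : intertwines O D Xi.
Proof.
have [lam0 _] := lamP.
split.
  elim/gen_cases=> [j|k]; last by apply/scomm0; exact: Xi_new.
  by rewrite ext_ops_old; apply: Xi_anti; exact: old_scomm.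
move=> g; have hact k := act_scomm repO g k.
have hJ : Kmx (mg_phi g) (opJ (newop O)) *m o_act O g =
    o_act O g *m opJ (newop O).
  by apply/scomm0; rewrite map_opJ; apply: (scomm_opJ (b := false)) => k _.
have hEps : Kmx (mg_phi g) (opEps (newop O)) *m o_act O g =
    o_act O g *m opEps (newop O).
  by apply/scomm0; rewrite map_opEps; apply: (scomm_opEps (b := false)) => k _.
have KXi : Kmx (mg_phi g) Xi = spread (Kmx (mg_phi g) (opJ (newop O)))
    (Kmx (mg_phi g) (opEps (newop O))) (Kmx (mg_phi g) C).
  exact: map_spread.
(* The action of g on the corner, seen in the whole module. *)
have hC : Kmx (mg_phi g) C *m
    (Kmx (mg_phi g) B *m (o_act O g *m jpow O (phib g)) *m C) =
    o_act O g *m (jpow O (phib g) *m C).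
  have KCB : Kmx (mg_phi g) C *m Kmx (mg_phi g) B = Kmx (mg_phi g) (ocorner O).
    by rewrite -map_mxM CB.
  have := corner_cancel 1%:M KCB (ocorner_act repO g) eC.
  by rewrite !mul1mx -(mulmxA (o_act O g)).
rewrite /= pauli2Z scalerA mulfV // scale1r KXi.
move: hC; rewrite /jpow; case: (phib g) => hC.
  apply: (spread_antilinear hJ hEps (frame_J2 frame) (frame_JEps frame)).
  by rewrite hC mulNmx mulmxN opprK.
apply: (spread_linear (b := false) hJ); last by rewrite hC mul1mx.
by rewrite expr0 scale1r.
Qed.

Lemma spread_even : even_mx O D Xi.
Proof. by apply: Xi_anti; exact: par_scomm. Qed.

Lemma spread_natural n' (O' : ops R G (p + (q + 4)) n') (S : 'M_(n, n'))
    r' (B' : 'M[R[i]]_(r', n')) C' :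
    intertwines O O' S ->
    C' *m B' = ocorner O' -> B' *m C' = 1%:M ->
  S *m spread (opJ (newop O')) (opEps (newop O')) C' =
  Xi *m ext_mx (B *m S *m C').
Proof.
move=> hS CB' BC'; have eC' : ocorner O' *m C' = C' := corner_mul CB' BC'.
apply: spread_linear.
- exact: opJ_intertwined.
- by rewrite expr0 scale1r; exact: opEps_intertwined.
- have := corner_cancel 1%:M CB (ocorner_intertwined hS) eC'.
  by rewrite !mul1mx.
Qed.

End ExtendRestriction.

Section Functors.
Context (R : realType) (G : magneticGroup) (lam : G -> R[i]).
Hypothesis lamP : is_trivialisation lam.
Variables p q : nat.

Definition ext_gmod (E : gmod R G p q) : gmod R G p (q + 4) :=
  gmod_of (ext_ops_rep lamP (ops_of_rep E)).

Lemma ext_mx_hom (E F : gmod R G p q) (S : 'M_(gm_dim E, gm_dim F)) :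
  is_hom S -> @is_hom _ _ _ _ (ext_gmod E) (ext_gmod F) (ext_mx S).
Proof.
move=> /is_hom_intertwines hS; apply/is_hom_intertwines; rewrite !gmod_ofK.
exact: ext_mx_intertwines.
Qed.

Lemma ext_mx_deg0 (E F : gmod R G p q) (S : 'M_(gm_dim E, gm_dim F)) :
  is_hom S -> is_deg0 S -> @is_deg0 _ _ _ _ (ext_gmod E) (ext_gmod F) (ext_mx S).
Proof.
move=> _ /is_deg0_even hS; apply/is_deg0_even; rewrite !gmod_ofK.
exact: ext_mx_even.
Qed.

Lemma ext_mx_linear m n : linear (@ext_mx R m n).
Proof. by move=> z S S'; rewrite /ext_mx pauli2D pauli2Z. Qed.

Lemma ext_mxM m n k (S : 'M[R[i]]_(m, n)) (S' : 'M_(n, k)) :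
  ext_mx (S *m S') = ext_mx S *m ext_mx S'.
Proof. by rewrite /ext_mx pauli2M expr0 scale1r. Qed.

Definition ext_functor : mxfunctor R G p q p (q + 4) :=
  @MxFunctor R G p q p (q + 4) ext_gmod (fun E F S => ext_mx S)
    (fun E F => @ext_mx_linear _ _) ext_mx_hom ext_mx_deg0
    (fun E => pauli2_scalar _ 1)
    (fun E F H S S' _ _ => ext_mxM S S').

Section Restriction.
Variable E : gmod R G p (q + 4).

Definition restr_in := row_base (ocorner (ops_of E)).
Definition restr_out := col_base (ocorner (ops_of E)).

Lemma restr_out_in : restr_out *m restr_in = ocorner (ops_of E).
Proof. exact: mulmx_base. Qed.

Lemma restr_in_out : restr_in *m restr_out = 1%:M.
Proof. exact/row_col_base/ocorner_idem/ops_of_rep. Qed.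

Definition restr_gmod : gmod R G p q :=
  gmod_of (compress_rep lamP (ops_of_rep E) restr_out_in restr_in_out).

End Restriction.

Definition restr_mx (E F : gmod R G p (q + 4)) (S : 'M_(gm_dim E, gm_dim F)) :
    'M[R[i]]_(gm_dim (restr_gmod E), gm_dim (restr_gmod F)) :=
  restr_in E *m S *m restr_out F.

Lemma restr_mx_linear E F : linear (@restr_mx E F).
Proof.
by move=> z S S'; rewrite /restr_mx mulmxDr mulmxDl -scalemxAr -scalemxAl.
Qed.

Lemma restr_mx_hom E F (S : 'M_(gm_dim E, gm_dim F)) :
  is_hom S -> is_hom (restr_mx S).
Proof.
move=> /is_hom_intertwines hS; apply/is_hom_intertwines; rewrite !gmod_ofK.
apply: compress_mx_intertwines => //; try exact: ops_of_rep;
  by [exact: restr_out_in|exact: restr_in_out].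
Qed.

Lemma restr_mx_deg0 E F (S : 'M_(gm_dim E, gm_dim F)) :
  is_hom S -> is_deg0 S -> is_deg0 (restr_mx S).
Proof.
move=> /is_hom_intertwines hS /is_deg0_even S0; apply/is_deg0_even.
rewrite !gmod_ofK.
apply: compress_mx_even => //; try exact: ops_of_rep;
  by [exact: restr_out_in|exact: restr_in_out].
Qed.

Lemma restr_mx1 E : restr_mx (1%:M : 'M_(gm_dim E)) = 1%:M.
Proof. by rewrite /restr_mx mulmx1; exact: restr_in_out. Qed.

Lemma restr_mxM E F H (S : 'M_(gm_dim E, gm_dim F))
    (S' : 'M_(gm_dim F, gm_dim H)) :
  is_hom S -> is_hom S' -> restr_mx (S *m S') = restr_mx S *m restr_mx S'.
Proof.
move=> _ /is_hom_intertwines hS'; rewrite /restr_mx.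
have eC := corner_mul (restr_out_in H) (restr_in_out H).
rewrite (corner_cancel _ (restr_out_in F) (ocorner_intertwined hS') eC).
by rewrite !mulmxA.
Qed.

Definition restr_functor : mxfunctor R G p (q + 4) p q :=
  MxFunctor restr_mx_linear restr_mx_hom restr_mx_deg0 restr_mx1 restr_mxM.

(** The corner of the extension of [E] is the first of the four copies of [E]. *)
Definition to_restr_ext (E : gmod R G p q) :
    'M[R[i]]_(gm_dim E, gm_dim (restr_functor (ext_functor E))) :=
  first_block R (gm_dim E) *m restr_out (ext_gmod E).

Lemma restr_ext_natural_iso :
  natural_iso (Phi := ext_functor) (Psi := restr_functor) to_restr_ext.
Proof.
have defD E : ops_of (ext_gmod E) = ext_ops lam (ops_of E) by exact: gmod_ofK.
have CB E := restr_out_in (ext_gmod E); have BC E := restr_in_out (ext_gmod E).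
split=> [E|E|E|E F S hS].
- apply/is_hom_intertwines; rewrite gmod_ofK.
  exact: (restr_ext_intertwines lamP (ops_of_rep E) (defD E) (CB E) (BC E)).
- apply/is_deg0_even; rewrite gmod_ofK.
  exact: (restr_ext_even lamP (ops_of_rep E) (defD E) (CB E) (BC E)).
- exists (restr_in (ext_gmod E) *m first_coblock R (gm_dim E)); split.
    exact: (first_block_out_in (defD E) (CB E)).
  exact: (first_block_in_out (defD E) (CB E) (BC E)).
- move/is_hom_intertwines: hS => hS.
  exact: (restr_ext_natural (defD E) (CB E) hS (defD F) (CB F) (BC F)).
Qed.

(** [E] is the sum of four translates of its corner, each a copy of it. *)
Definition to_ext_restr (E : gmod R G p (q + 4)) :
    'M[R[i]]_(gm_dim E, gm_dim (ext_functor (restr_functor E))) :=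
  spread (opJ (newop (ops_of E))) (opEps (newop (ops_of E))) (restr_out E).

Lemma ext_restr_natural_iso :
  natural_iso (Phi := restr_functor) (Psi := ext_functor) to_ext_restr.
Proof.
split=> [E|E|E|E F S hS].
- apply/is_hom_intertwines; rewrite !gmod_ofK.
  exact: (spread_intertwines lamP (ops_of_rep E) (restr_out_in E) (restr_in_out E)).
- apply/is_deg0_even; rewrite !gmod_ofK.
  exact: (spread_even lam (ops_of_rep E) (restr_out_in E) (restr_in_out E)).
- exists (gather (opJ (newop (ops_of E))) (opEps (newop (ops_of E))) (restr_in E)).
  have frame := newop_frame (ops_of_rep E).
  split; first exact: (spreadK frame (restr_out_in E)).
  exact: (gatherK frame (restr_out_in E) (restr_in_out E)).
- move/is_hom_intertwines: hS => hS.
  exact: (spread_natural (restr_out_in E) hS (restr_out_in F) (restr_in_out F)).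
Qed.

End Functors.

Theorem corollary3p5 (R : realType) (G : magneticGroup)
    (htriv : same_H2_class (phi_sigma R G) (fun _ _ => 1))
    (p q : nat) :
  exists f : {additive KG R G p (q + 4)%N -> KG R G p q}, bijective f.
Proof.
have [lam lamP] := trivialisation_exists htriv.
exists (KG_map (restr_functor lamP p q)).
exists (KG_map (ext_functor lamP p q)).
  exact: KG_mapK (ext_restr_natural_iso lamP p q).
exact: KG_mapK (restr_ext_natural_iso lamP p q).
Qed.
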